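(* Let $0<\alpha<1$ and $\theta>-\alpha$, and for each $n$ let $\Pi_n$ be the Ewens-Pitman random partition of $[n]$ with parameters $(\alpha,\theta)$, with smallest block size $|A_{(|\Pi_n|)}|$. For integers $r=r(n)\ge 2$ with $r=o(n)$, $$\mathbb{P}(|A_{(|\Pi_n|)}|\ge r)\sim\frac{\Gamma(1+\theta)}{\Gamma(1-\alpha)}\left\{\sum_{j=1}^{r-1}p_{\alpha}(j)\right\}^{-1-\frac{\theta}{\alpha}}n^{-\theta-\alpha},\qquad n\to\infty,$$ where $$p_\alpha(j)=\binom{\alpha}{j}(-1)^{j+1},\qquad j=1,2,\dots$$ Moreover, if in addition $r\to\infty$, $$\mathbb{P}(|A_{(|\Pi_n|)}|\ge r)\sim\frac{\Gamma(1+\theta)}{\Gamma(1-\alpha)}n^{-\theta-\alpha},\qquad n,r\to\infty,\quad r=o(n).$$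
   Context: $[n]=\{1,\dots,n\}$. A partition of $[n]$ into $k$ blocks is an unordered collection of $k$ nonempty disjoint sets with union $[n]$. For a random partition $\Pi_n$ of $[n]$, $|\Pi_n|$ is the number of blocks, $|\Pi_n|_j$ is the number of blocks of size $j$, and $|A_{(1)}|\ge\cdots\ge|A_{(|\Pi_n|)}|$ are the block sizes in descending order, so $|A_{(|\Pi_n|)}|$ is the smallest block size. Write $(x)_{i;a}=x(x+a)\cdots(x+(i-1)a)$, $(x)_{0;a}=1$, and $(x)_i=(x)_{i;1}$. The Ewens-Pitman partition with parameters $(\alpha,\theta)$, $0\le\alpha<1$, $\theta>-\alpha$, is the exchangeable random partition of $[n]$ in which a given partition of $[n]$ with blocks of sizes $n_1,\dots,n_k$ has probability $$\frac{(\theta)_{k;\alpha}}{(\theta)_n}\prod_{j=1}^k(1-\alpha)_{n_j-1}.$$ When $\theta=0$ the ratio $(\theta)_{k;\alpha}/(\theta)_n$ is read as $(\theta+\alpha)_{k-1;\alpha}/(\theta+1)_{n-1}$. The symbol $a_n\sim b_n$ means $a_n/b_n\to1$. *)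

(* Defs.v *)
From HB Require Import structures.
From mathcomp Require Import all_boot all_order all_algebra.
From mathcomp Require Import all_classical all_reals all_analysis.
Set Implicit Arguments.
Unset Strict Implicit.
Unset Printing Implicit Defensive.
Import Order.TTheory GRing.Theory Num.Theory.
Import numFieldNormedType.Exports.
Local Open Scope classical_set_scope.
Local Open Scope ring_scope.

(* (x)_{i;a} = x (x + a) ... (x + (i - 1) a). *)
Definition rising (R : realType) (x : R) (i : nat) (a : R) : R :=
  \prod_(j < i) (x + j%:R * a).

Definition gen_binom (R : realType) (x : R) (j : nat) : R :=
  (\prod_(i < j) (x - i%:R)) / j`!%:R.

Definition p_alpha (R : realType) (alpha : R) (j : nat) : R :=
  gen_binom alpha j * (-1) ^+ j.+1.

(* Euler's integral; it is the Gamma function for 0 < x only, which is all that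
   is needed since 0 < 1 - alpha < 1 + theta. *)
Definition Gamma (R : realType) (x : R) : R :=
  \int[lebesgue_measure]_(t in `]0, +oo[) (t `^ (x - 1) * expR (- t)).

(* The set [n] is represented by 'I_n, and a partition of [n] by its set of
   blocks. *)
Definition block_sizes (n : nat) (A : {set {set 'I_n}}) : seq nat :=
  sort geq [seq #|B| | B : {set 'I_n} in A].

Definition smallest_block_size (n : nat) (A : {set {set 'I_n}}) : nat :=
  last 0%N (block_sizes A).

(* (theta)_{k;alpha} / (theta)_n, with the common factor theta cancelled when
   theta = 0. *)
Definition EP_ratio (R : realType) (alpha theta : R) (n k : nat) : R :=
  if theta == 0
  then rising (theta + alpha) k.-1 alpha / rising (theta + 1) n.-1 1
  else rising theta k alpha / rising theta n 1.

Definition EP_prob (R : realType) (alpha theta : R) (n : nat)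
    (A : {set {set 'I_n}}) : R :=
  EP_ratio alpha theta n #|A| * \prod_(B in A) rising (1 - alpha) #|B|.-1 1.

(* The set of partitions of [n] is finite, so measurability of a random
   partition amounts to measurability of its fibres. *)
Record EwensPitman (R : realType) (alpha theta : R) (n : nat)
    (d : measure_display) (T : measurableType d) (P : probability T R)
    (Pi : T -> {set {set 'I_n}}) : Prop := {
  EP_partition : forall w, finset.partition (Pi w) [set: 'I_n]%SET ;
  EP_measurable : forall A, measurable (Pi @^-1` [set A]) ;
  EP_law : forall A, finset.partition A [set: 'I_n]%SET ->
    P (Pi @^-1` [set A]) = (EP_prob alpha theta A)%:E }.

Definition asymp_equiv (R : realType) (a b : nat -> R) : Prop :=
  a n / b n @[n --> \oo] --> (1 : R).

(* Main.v *)
(* The block of the element 1 has some size j; summing out the rest shows that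
   P(smallest block >= r) is N!/(alpha (theta+1)_N) times
     T = sum_{j=r}^{n} j p_alpha(j) h_{n-j},  n = N+1,
   where h_m is the coefficient of x^m in (1 - q(x))^{-g}, q(x) = sum_{j>=r} p_alpha(j) x^j
   and g = 1 + theta/alpha > 0 (no case distinction at theta = 0). The sequence j p_alpha(j)
   is slowly decreasing, so T is close to n p_alpha(n) sum_m h_m, and
   sum_m h_m = (1 - q(1))^{-g} = (sum_{j<r} p_alpha(j))^{-g}. The point is uniformity in r:
   partial sums of (h_m) are squeezed between truncated binomial series evaluated at
   truncations of q(1) <= 1 - alpha, and m h_m -> 0 uniformly because m h_m is g times the
   convolution of j p_alpha(j) with the coefficients of (1 - q)^{-g-1}. The powers of n come
   from Euler's limit N! (N+1)^{x-1} / (x)_N -> Gamma(x). *)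
Require Import Defs.
From HB Require Import structures.
From mathcomp Require Import all_boot all_order all_algebra.
From mathcomp Require Import all_classical all_reals all_analysis.
From mathcomp Require Import zify ring lra.
Import Order.TTheory GRing.Theory Num.Theory.
Import numFieldNormedType.Exports.
Local Open Scope classical_set_scope.
Local Open Scope ring_scope.
Set Implicit Arguments.
Unset Strict Implicit.
Unset Printing Implicit Defensive.

(** * Rising factorials *)

Section Rising.
Context {R : realType}.
Implicit Types x a : R.

Lemma rising0 x a : rising x 0 a = 1.
Proof. by rewrite /rising big_ord0. Qed.

Lemma rising_gt0 x n a : 0 < x -> 0 <= a -> 0 < rising x n a.
Proof. by move=> x0 a0; apply: prodr_gt0 => i _; rewrite ltr_wpDr ?mulr_ge0. Qed.

Lemma risingS x n a : rising x n.+1 a = rising x n a * (x + n%:R * a).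
Proof. by rewrite /rising big_ord_recr. Qed.

Lemma risingSl x n a : rising x n.+1 a = x * rising (x + a) n a.
Proof.
rewrite /rising big_ord_recl mul0r addr0; congr (_ * _).
by apply: eq_bigr => i _; rewrite lift0 -natr1; ring.
Qed.

Lemma rising11 n : rising 1 n 1 = n`!%:R :> R.
Proof.
elim: n => [|n IH]; first by rewrite rising0.
by rewrite risingS IH mulr1 factS natrM mulrC addrC natr1.
Qed.

End Rising.

(** * Euler's limit for the Gamma function *)

Section GammaLimit.
Context {R : realType}.
Local Notation mu := (@lebesgue_measure R).
Implicit Types a b t x y : R.

Definition gamma_kernel x t : R := t `^ (x - 1) * expR (- t).

Lemma gamma_kernel_ge0 x t : 0 <= gamma_kernel x t.
Proof. by rewrite mulr_ge0 ?powR_ge0 ?expR_ge0. Qed.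

Lemma is_derive_gamma_kernel x t : 0 < t ->
  is_derive t 1 (gamma_kernel (x + 1)) (x * gamma_kernel x t - gamma_kernel (x + 1) t).
Proof.
move=> t0; rewrite /gamma_kernel addrK.
have Hp := is_derive1_powR x t0.
have He : is_derive t 1 (fun u : R => expR (- u)) (- expR (- t)).
  by apply: is_derive_eq; rewrite /GRing.scale /=; ring.
have -> : x * (t `^ (x - 1) * expR (- t)) - t `^ x * expR (- t) =
  t `^ x *: (- expR (- t)) + expR (- t) *: (x * t `^ (x - 1)).
  by rewrite /GRing.scale /=; ring.
exact: is_deriveM.
Qed.

Lemma gamma_kernel_derivable x t : 0 < t -> derivable (gamma_kernel x) t 1.
Proof.
by move=> t0; rewrite -(subrK 1 x); apply: ex_derive; exact: is_derive_gamma_kernel.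
Qed.

Lemma gamma_kernel_continuous x a b : 0 < a ->
  {within `[a, b], continuous (gamma_kernel x)}.
Proof.
move=> a0; apply: derivable_within_continuous => t.
by rewrite in_itv/= => /andP[/(lt_le_trans a0) t0 _]; exact: gamma_kernel_derivable.
Qed.

Lemma gamma_kernel_integrable x a b : 0 < a ->
  mu.-integrable `[a, b] (EFin \o gamma_kernel x).
Proof.
move=> a0; apply: continuous_compact_integrable; first exact: segment_compact.
exact: gamma_kernel_continuous.
Qed.

Definition gamma_itv a b x : R := \int[mu]_(t in `[a, b]) gamma_kernel x t.

(** Integration by parts: the fundamental theorem of calculus for t^x e^{-t}, on an interval that
    avoids the singularity at 0. *)
Lemma gamma_itvD1 a b x : 0 < a -> a < b ->
  gamma_itv a b (x + 1) =
  x * gamma_itv a b x + gamma_kernel (x + 1) a - gamma_kernel (x + 1) b.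
Proof.
move=> a0 ab.
have FTC : (\int[mu]_(t in `[a, b]) (x * gamma_kernel x t - gamma_kernel (x + 1) t) =
    gamma_kernel (x + 1) b - gamma_kernel (x + 1) a)%R.
  rewrite /Rintegral (@continuous_FTC2 _ _ (gamma_kernel (x + 1)))//.
  - apply: derivable_within_continuous => t.
    rewrite in_itv/= => /andP[/(lt_le_trans a0) t0 _].
    by apply: derivableB; [apply: derivableM => //|]; exact: gamma_kernel_derivable.
  - have /continuous_within_itvP := @gamma_kernel_continuous (x + 1) a b a0.
    move=> /(_ ab)[_ Ha Hb]; split => // t.
    rewrite in_itv/= => /andP[/(lt_trans a0) t0 _]; exact: gamma_kernel_derivable.
  - move=> t; rewrite in_itv/= => /andP[/(lt_trans a0) t0 _].
    by rewrite derive1E; have [_ ->] := is_derive_gamma_kernel x t0.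
have xint : mu.-integrable `[a, b] (EFin \o (fun t => x * gamma_kernel x t)).
  exact: (integrableZl _ x (gamma_kernel_integrable x b a0)).
move: FTC; rewrite RintegralB//; last exact: gamma_kernel_integrable.
rewrite RintegralZl//; last exact: gamma_kernel_integrable.
rewrite -/(gamma_itv a b x) -/(gamma_itv a b (x + 1)); lra.
Qed.


(** These intervals exhaust ]0, +oo[; the shift by 2 makes them nondegenerate already at n = 0, as
    [gamma_itvD1] requires. *)
Definition gamma_trunc x (n : nat) : R := gamma_itv n.+2%:R^-1 n.+2%:R x.

Let inv_gt0 n : 0 < n.+2%:R^-1 :> R. Proof. by rewrite invr_gt0. Qed.

Let inv_le1 n : n.+2%:R^-1 <= 1 :> R.
Proof. by rewrite invf_le1// ler1n. Qed.

Let inv_lt n : n.+2%:R^-1 < n.+2%:R :> R.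
Proof. by rewrite (le_lt_trans (inv_le1 n))// ltr1n. Qed.

Lemma bigcup_itv_inv : \bigcup_n [set` `[(n.+2%:R^-1 : R), n.+2%:R]] = [set` `]0%R, +oo[].
Proof.
apply/seteqP; split => t /=.
  by move=> [n _] /=; rewrite !in_itv/= andbT => /andP[/(lt_le_trans (inv_gt0 n))].
rewrite in_itv/= andbT => t0.
exists (maxn (Num.bound t) (Num.bound t^-1)) => //=; rewrite in_itv/=.
have bM m (y : R) : 0 < y -> (Num.bound y <= m)%N -> y <= m.+2%:R.
  move=> y0 ym; rewrite (le_trans (ltW (archi_boundP (ltW y0))))// ler_nat.
  by rewrite (leq_trans ym)// -addn2 leq_addr.
rewrite bM ?leq_maxl// andbT -[leRHS]invrK lef_pV2 ?posrE ?invr_gt0//.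
by rewrite bM ?invr_gt0 ?leq_maxr.
Qed.

(** Monotone convergence. The bound [M] keeps the extended integral finite; [fine] would send an
    infinite one to 0. *)
Lemma cvg_gamma_trunc x : (exists M, forall n, gamma_trunc x n <= M) ->
  gamma_trunc x n @[n --> \oo] --> Gamma x.
Proof.
move=> [M HM].
pose F n : set R := [set` `[n.+2%:R^-1, n.+2%:R]].
have ndF : nondecreasing_seq F.
  move=> m n mn; apply/subsetPset => t; rewrite /F /= !in_itv/= => /andP[mt tm].
  by rewrite (le_trans _ mt) ?lef_pV2 ?posrE ?(le_trans tm)// ler_nat.
have IE n : (\int[mu]_(t in F n) (gamma_kernel x t)%:E = (gamma_trunc x n)%:E)%E.
  by rewrite fineK// integrable_fin_num//; exact: gamma_kernel_integrable.
have /= := @ge0_nondecreasing_set_cvg_integral _ (measurableTypeR R) R F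
  (fun t => (gamma_kernel x t)%:E) lebesgue_measure ndF.
rewrite bigcup_itv_inv.
move=> cvgI.
have {}cvgI : (\int[mu]_(t in F n) (gamma_kernel x t)%:E)%E @[n --> \oo] -->
    (\int[mu]_(t in `]0%R, +oo[) (gamma_kernel x t)%:E)%E.
  apply: cvgI => [n|n|n t _]; [exact: measurable_itv| |].
  - by have /measurable_int := gamma_kernel_integrable x n.+2%:R (inv_gt0 n).
  - by rewrite lee_fin gamma_kernel_ge0.
apply: fine_cvg; rewrite fineK; first exact: cvgI.
rewrite ge0_fin_numE; last first.
  by apply: integral_ge0 => t _; rewrite lee_fin; exact: gamma_kernel_ge0.
apply: (@le_lt_trans _ _ M%:E); last exact: ltry.
by apply: cvge_le cvgI; apply: nearW => n; rewrite IE lee_fin.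
Qed.

(** A single term of the exponential series suffices: t^{k+1}/(k+1)! <= e^t with k >= |x - 1|. *)
Lemma gamma_kernel_decay x : exists C, forall t, 1 <= t -> gamma_kernel x t <= C / t.
Proof.
pose k := Num.bound `|x - 1|; exists k.+1`!%:R => t t1.
have t0 : 0 < t by apply: lt_le_trans t1.
have xk : t `^ (x - 1) <= t ^+ k.
  rewrite -powR_mulrn ?(ltW t0)// ler_powR//.
  by rewrite (le_trans (ler_norm _))// ltW//; exact: archi_boundP.
rewrite /gamma_kernel expRN ler_pdivrMr ?expR_gt0// mulrAC ler_pdivlMr//.
apply: (@le_trans _ _ (t ^+ k.+1)).
  by rewrite exprSr ler_pM2r.
have /(le_trans _) := expR_ge1Dxn k (ltW t0).
move=> /(_ (t ^+ k.+1 / k.+1`!%:R)) h.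
by rewrite mulrC -ler_pdivrMr ?ltr0n ?fact_gt0// h// lerDr.
Qed.

Let cvg_inv2 : (n.+2%:R^-1 : R) @[n --> \oo] --> 0.
Proof. by rewrite (cvg_shiftS (@harmonic R)); exact: cvg_harmonic. Qed.

Lemma cvg_gamma_kernely x : gamma_kernel x n.+2%:R @[n --> \oo] --> 0.
Proof.
have [C HC] := gamma_kernel_decay x.
apply: (@squeeze_cvgr _ _ _ _ (fun=> 0) (fun n => C * n.+2%:R^-1)).
- by apply: nearW => n; rewrite gamma_kernel_ge0 HC// ler1n.
- exact: cvg_cst.
- by rewrite -(mulr0 C); apply: cvgMr; exact: cvg_inv2.
Qed.

Lemma cvg_gamma_kernel0 x : 0 < x -> gamma_kernel (x + 1) n.+2%:R^-1 @[n --> \oo] --> 0.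
Proof.
move=> x0.
apply: (@squeeze_cvgr _ _ _ _ (fun=> 0) (fun n => n.+2%:R^-1 `^ x)).
- apply: nearW => n /=.
  by rewrite gamma_kernel_ge0 /gamma_kernel addrK ler_piMr ?powR_ge0// expR_le1 oppr_le0.
- exact: cvg_cst.
- have /cvg_at_rightP := powR_cvg0 x0; apply; split => //.
Qed.

Lemma gamma_truncD1 x n : gamma_trunc (x + 1) n =
  x * gamma_trunc x n + gamma_kernel (x + 1) n.+2%:R^-1 - gamma_kernel (x + 1) n.+2%:R.
Proof. exact: gamma_itvD1. Qed.

Lemma gamma_kernel_le1 x t : 0 <= x -> 0 < t <= 1 -> gamma_kernel (x + 1) t <= 1.
Proof.
move=> x0 /andP[t0 t1]; rewrite /gamma_kernel addrK mulr_ile1 ?powR_ge0 ?expR_ge0//.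
  by rewrite -(powRr0 t) ger_powR ?t0.
by rewrite expR_le1 oppr_le0 ltW.
Qed.

(** Induction through [gamma_truncD1], started at x = 0 where the integral on the right has
    coefficient 0. The left boundary term is at most 1 and the right one is subtracted. *)
Let bounded_natS k : exists M, forall n, gamma_trunc k.+1%:R n <= M.
Proof.
elim: k => [|k [M HM]].
  exists 1 => n; have := gamma_truncD1 0 n; rewrite add0r mul0r add0r => ->.
  rewrite lerBlDr (le_trans _ (_ : 1 <= _))//.
    by rewrite -[X in gamma_kernel X]add0r gamma_kernel_le1// inv_gt0 inv_le1.
  by rewrite lerDl gamma_kernel_ge0.
exists (k.+1%:R * M + 1) => n; rewrite -(natr1 k.+1) gamma_truncD1.
rewrite lerBlDr -[leLHS]addr0 lerD ?gamma_kernel_ge0// lerD ?ler_wpM2l//.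
by rewrite gamma_kernel_le1// inv_gt0 inv_le1.
Qed.

(** The kernel is dominated by the sum of two kernels with integer parameter: t^{x-1} <= 1 for t <=
    1, and t^{x-1} <= t^k for t > 1. *)
Let bounded_ge1 x : 1 <= x -> exists M, forall n, gamma_trunc x n <= M.
Proof.
move=> x1; pose k := Num.bound x.
have [M HM] := bounded_natS 0; have [M' HM'] := bounded_natS k.
exists (M + M') => n; apply: le_trans (lerD (HM n) (HM' n)).
rewrite -RintegralD//; [|exact: gamma_kernel_integrable..].
apply: le_Rintegral => //; first exact: gamma_kernel_integrable.
  exact: (integrableD _ (gamma_kernel_integrable _ _ (inv_gt0 n))
    (gamma_kernel_integrable _ _ (inv_gt0 n))).
move=> t; rewrite /= in_itv/= => /andP[/(lt_le_trans (inv_gt0 n)) t0 _].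
rewrite /gamma_kernel subrr powRr0 -mulrDl ler_wpM2r ?expR_ge0//.
have [t1|t1] := leP t 1.
  rewrite -[leLHS]addr0 lerD ?powR_ge0// -[leRHS](powRr0 t) ger_powR ?t0//.
  by rewrite subr_ge0.
rewrite -[leLHS]add0r lerD// ler_powR ?(ltW t1)// lerB//.
by rewrite -natr1 ler_wpDr// ltW//; apply: archi_boundP; rewrite (le_trans ler01).
Qed.

(** Dividing the functional equation by x carries the bound from x + 1 >= 1 down to x. *)
Lemma gamma_trunc_bounded x : 0 < x -> exists M, forall n, gamma_trunc x n <= M.
Proof.
move=> x0; have [|M HM] := @bounded_ge1 (x + 1); first by rewrite lerDr ltW.
have [C HC] := gamma_kernel_decay (x + 1).
exists ((M + `|C|) / x) => n; rewrite ler_pdivlMr// mulrC.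
have -> : x * gamma_trunc x n = gamma_trunc (x + 1) n
   - gamma_kernel (x + 1) n.+2%:R^-1 + gamma_kernel (x + 1) n.+2%:R.
  by rewrite gamma_truncD1; ring.
rewrite lerD//.
  by rewrite lerBlDr (le_trans (HM n))// lerDl gamma_kernel_ge0.
rewrite (le_trans (HC _ _)) ?ler1n// ler_pdivrMr// (le_trans (ler_norm _))//.
by rewrite ler_peMr// ler1n.
Qed.

Lemma gamma_trunc_cvg x : 0 < x -> gamma_trunc x n @[n --> \oo] --> Gamma x.
Proof. by move=> /gamma_trunc_bounded/cvg_gamma_trunc. Qed.

Lemma GammaD1 x : 0 < x -> Gamma (x + 1) = x * Gamma x.
Proof.
move=> x0; have x10 : 0 < x + 1 by rewrite addr_gt0.
apply: (cvg_unique _ (gamma_trunc_cvg x10)) => //.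
rewrite /mkset (_ : gamma_trunc (x + 1) = fun n => x * gamma_trunc x n +
    gamma_kernel (x + 1) n.+2%:R^-1 - gamma_kernel (x + 1) n.+2%:R); last first.
  by apply/funext => n; exact: gamma_truncD1.
rewrite -[X in _ --> X]addr0 -[X in _ --> X]subr0.
apply: cvgB; last exact: cvg_gamma_kernely.
by apply: cvgD; [apply: cvgMr; exact: gamma_trunc_cvg|exact: cvg_gamma_kernel0].
Qed.

Lemma Gamma1 : Gamma 1 = 1 :> R.
Proof.
apply: (cvg_unique _ (gamma_trunc_cvg ltr01)) => //.
have -> : gamma_trunc 1 = fun n => expR (- n.+2%:R^-1) - gamma_kernel (0 + 1) n.+2%:R.
  apply/funext => n; rewrite -[X in gamma_trunc X]add0r gamma_truncD1 mul0r add0r.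
  by congr (_ - _); rewrite /gamma_kernel addrK powRr0 mul1r.
rewrite /mkset -[X in _ --> X]subr0 -[X in _ --> X - _]expR0 -[X in _ --> expR X - _]oppr0.
apply: cvgB; last exact: cvg_gamma_kernely.
apply: continuous_cvg; first exact: continuous_expR.
exact: cvgN.
Qed.

(** * A convexity bound for Gamma and Euler's limit *)

(** The tangent at u = 1, obtained from Young's inequality for u^s and 1 with exponents 1/s and 1/(1
    - s); s = 0 and s = 1 are treated apart. *)
Lemma powR_le_tangent s (u : R) : 0 <= s <= 1 -> 0 < u -> u `^ s <= 1 - s + s * u.
Proof.
move=> /andP[]; rewrite le_eqVlt => /predU1P[<- _ _|s0].
  by rewrite powRr0 subr0 mul0r addr0.
rewrite le_eqVlt => /predU1P[-> u0|s1 u0].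
  by rewrite powRr1 ?(ltW u0)// subrr add0r mul1r.
have := @conjugate_powR _ (u `^ s) 1 s^-1 (1 - s)^-1.
rewrite powR_ge0 ler01 !invr_gt0 s0 subr_gt0 s1 !invrK -powRrM mulfV ?gt_eqF//.
rewrite powRr1 ?(ltW u0)// powR1 mulr1 mul1r subrKC => /(_ isT isT isT isT erefl).
lra.
Qed.

(* Integrating the tangent line of the concave function t^s at t = y against the
   Gamma kernel replaces the usual appeal to Hoelder's inequality. *)
Lemma GammaD_le y s : 0 < y -> 0 <= s <= 1 -> Gamma (y + s) <= y `^ s * Gamma y.
Proof.
move=> y0 s01; have [s0 s1] := andP s01.
have ys0 : 0 < y + s by rewrite ltr_wpDr.
have -> : y `^ s * Gamma y =
    y `^ s * ((1 - s) * Gamma y) + y `^ s * (s / y * Gamma (y + 1)).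
  by rewrite GammaD1// -mulrDr mulrA divfK ?gt_eqF//; ring.
have cvgR : y `^ s * ((1 - s) * gamma_trunc y n) +
    y `^ s * (s / y * gamma_trunc (y + 1) n) @[n --> \oo] -->
    y `^ s * ((1 - s) * Gamma y) + y `^ s * (s / y * Gamma (y + 1)).
  by apply: cvgD; do 2 apply: cvgMr; apply: gamma_trunc_cvg => //; rewrite addr_gt0.
apply: ler_cvg_to (gamma_trunc_cvg ys0) cvgR _; apply: nearW => n.
have int z := gamma_kernel_integrable z n.+2%:R (inv_gt0 n).
have intZ c z : mu.-integrable [set` `[n.+2%:R^-1, n.+2%:R]]
    (EFin \o (fun t => c * gamma_kernel z t)).
  exact: (integrableZl _ c (int z)).
rewrite !mulrA /gamma_trunc /gamma_itv -!RintegralZl// -RintegralD//.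
apply: le_Rintegral => //.
  exact: (integrableD _ (intZ _ _) (intZ _ _)).
move=> t; rewrite /= in_itv/= => /andP[/(lt_le_trans (inv_gt0 n)) t0 _].
have h : t `^ s <= y `^ s * (1 - s + s * (t / y)).
  have -> : t `^ s = y `^ s * (t / y) `^ s.
    by rewrite -powRM ?(ltW y0) ?(ltW (divr_gt0 t0 y0))// mulrC divfK// gt_eqF.
  by rewrite ler_wpM2l ?powR_ge0// powR_le_tangent// divr_gt0.
rewrite /gamma_kernel addrK.
have -> : t `^ (y + s - 1) = t `^ (y - 1) * t `^ s.
  by rewrite -powRD ?(gt_eqF t0) ?implybT// addrAC.
have -> : t `^ y = t * t `^ (y - 1) by rewrite mulr_powRB1// ltW.
apply: (le_trans (ler_wpM2r (expR_ge0 _) (ler_wpM2l (powR_ge0 _ _) h))).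
by rewrite le_eqVlt; apply/orP; left; apply/eqP; ring.
Qed.

Lemma GammaDn x n : 0 < x -> Gamma (x + n%:R) = rising x n 1 * Gamma x.
Proof.
move=> x0; elim: n => [|n IH]; first by rewrite addr0 rising0 mul1r.
have -> : x + n.+1%:R = x + n%:R + 1 by rewrite -natr1 addrA.
rewrite GammaD1; last by rewrite ltr_wpDr.
by rewrite IH risingS mulr1 mulrA (mulrC (x + _)).
Qed.

Lemma Gamma_natS n : Gamma n.+1%:R = n`!%:R :> R.
Proof. by rewrite -natr1 addrC GammaDn// rising11 Gamma1 mulr1. Qed.

(** Reduces claims on positive reals to ]0, 1], where both x and 1 - x are admissible exponents in
    [GammaD_le]. *)
Lemma pos_addr1_ind (Q : R -> Prop) : (forall x, 0 < x <= 1 -> Q x) ->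
  (forall x, 0 < x -> Q x -> Q (x + 1)) -> forall x, 0 < x -> Q x.
Proof.
move=> Q1 QS x.
have : x <= (Num.bound `|x|)%:R.
  by rewrite (le_trans (ler_norm _))// ltW//; exact: archi_boundP.
move: (Num.bound _) => k; elim: k x => [x|k IH x xk x0].
  by move=> /le_lt_trans/[apply]; rewrite ltxx.
have [x1|x1] := leP x 1; first by apply: Q1; rewrite x0.
rewrite -(subrK 1 x); apply: QS; first by rewrite subr_gt0.
by apply: IH; rewrite ?subr_gt0// lerBlDr natr1.
Qed.

Lemma Gamma_gt0 x : 0 < x -> 0 < Gamma x.
Proof.
move: x; apply: pos_addr1_ind => [x /andP[x0 x1]|x x0 Gx]; last first.
  by rewrite GammaD1// mulr_gt0.
have s01 : 0 <= 1 - x <= 1 by rewrite subr_ge0 x1 gerBl ltW.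
have := GammaD_le x0 s01; rewrite subrKC Gamma1 => /(lt_le_trans ltr01).
by rewrite pmulr_rgt0// powR_gt0.
Qed.

Lemma cvg_nDx_ratio x : (n%:R + x) / n.+1%:R @[n --> \oo] --> (1 : R).
Proof.
rewrite (_ : (fun n => _) = fun n => 1 + (x - 1) * harmonic n); last first.
  by apply/funext => n; rewrite /harmonic /=; field; rewrite nat1r.
rewrite -[X in _ --> X]addr0 -(mulr0 (x - 1)); apply: cvgD; first exact: cvg_cst.
by apply: cvgMr; exact: cvg_harmonic.
Qed.

(** The functional equation extends the limit from ]0, 1]; there, two uses of [GammaD_le] squeeze
    the quotient. *)
Lemma Gamma_limit x : 0 < x ->
  n`!%:R * n.+1%:R `^ (x - 1) / rising x n 1 @[n --> \oo] --> Gamma x.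
Proof.
move: x; apply: pos_addr1_ind => [x /andP[x0 x1]|x x0 IH]; last first.
  rewrite GammaD1// mulrC (_ : (fun n => _) = fun n =>
    (n`!%:R * n.+1%:R `^ (x - 1) / rising x n 1) * (x / ((n%:R + x) / n.+1%:R))).
    apply: cvgM IH _; rewrite -[X in _ --> X]divr1; apply: cvgMr.
    by apply: cvgV; [exact: oner_neq0|exact: cvg_nDx_ratio].
  apply/funext => n; rewrite addrK.
  have xn0 : x + n%:R != 0 by rewrite gt_eqF// ltr_wpDr.
  have -> : n.+1%:R `^ x = n.+1%:R * n.+1%:R `^ (x - 1) :> R by rewrite mulr_powRB1.
  have -> : rising (x + 1) n 1 = rising x n 1 * (x + n%:R) / x.
    by apply: canRL (mulfK _) _; rewrite ?gt_eqF// mulrC -risingSl risingS mulr1.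
  have r0 : rising x n 1 != 0 by rewrite gt_eqF// rising_gt0.
  by field; rewrite r0 (gt_eqF x0) (addrC n%:R) xn0 nat1r pnatr_eq0.
apply: (@squeeze_cvgr _ _ _ _ (fun n => Gamma x * ((n%:R + x) / n.+1%:R)) (fun=> Gamma x)).
- apply: nearW => n.
  have xr : 0 < rising x n 1 by rewrite rising_gt0.
  have nx0 : 0 < n%:R + x by rewrite ltr_wpDl.
  have n0 : (0 : R) < n.+1%:R by [].
  have s01 : 0 <= 1 - x <= 1 by rewrite subr_ge0 x1 gerBl ltW.
  rewrite ler_pdivlMr// ler_pdivrMr//; apply/andP; split.
    (* Lower bound: Gamma(n + 1 + x) <= (n + 1)^x n!. *)
    have := @GammaD_le n.+1%:R x n0; rewrite x1 (ltW x0) => /(_ isT).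
    rewrite (addrC _ x) GammaDn// Gamma_natS risingS mulr1.
    have -> : n.+1%:R `^ x = n.+1%:R * n.+1%:R `^ (x - 1) :> R by rewrite mulr_powRB1.
    rewrite (_ : _ * _ * rising x n 1 =
      rising x n 1 * (x + n%:R) * Gamma x / n.+1%:R); last by ring.
    by rewrite ler_pdivrMr// (mulrAC n.+1%:R) (mulrC n.+1%:R) (mulrAC _ n.+1%:R).
  (* Upper bound: n! = Gamma(n + x + (1 - x)) <= (n + x)^{1-x} Gamma(n + x), and n + x <= n + 1. *)
  have := GammaD_le nx0 s01.
  rewrite addrA (addrC _ 1) -addrA addrK nat1r Gamma_natS (addrC _ x) GammaDn//.
  move=> h; rewrite -[x - 1]opprB powRN ler_pdivrMr ?powR_gt0//.
  rewrite (le_trans h)// mulrC (mulrC (Gamma x)).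
  rewrite ler_wpM2l ?mulr_ge0 ?(ltW xr) ?(ltW (Gamma_gt0 x0))//.
  rewrite ge0_ler_powR ?nnegrE ?subr_ge0// ?addr_ge0 ?(ltW x0)//.
  by rewrite -nat1r lerD2r.
- by rewrite -[X in _ --> X]mulr1; apply: cvgMr; exact: cvg_nDx_ratio.
- exact: cvg_cst.
Qed.

End GammaLimit.

(** * Sums over set partitions *)

Section PartitionSums.
Local Open Scope set_scope.
Local Open Scope ring_scope.
Context {R : comPzRingType} (w : nat -> R).

(** Partition function of a Gibbs-type law: [v] weighs the number of blocks and [w] each block size.
    Arbitrary sets D are allowed so that removing a block stays within the definition. *)
Definition partition_sum (T : finType) (v : nat -> R) (D : {set T}) : R :=
  \sum_(A : {set {set T}} | finset.partition A D) v #|A| * \prod_(B in A) w #|B|.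

Lemma partition_sum0 (T : finType) v : partition_sum v (finset.set0 : {set T}) = v 0%N.
Proof.
rewrite /partition_sum (big_pred1 finset.set0) => [|A].
  by rewrite finset.cards0 finset.big_set0 mulr1.
by rewrite finset.partition_set0.
Qed.

(** Partitions are classified by the block S of x. Removing S is a bijection onto the partitions of
    D minus S and lowers the number of blocks by one, whence the shift of [v]. *)
Lemma partition_sum_pblock (T : finType) v (D : {set T}) x : x \in D ->
  partition_sum v D =
  \sum_(S : {set T} | (S \subset D) && (x \in S))
     w #|S| * partition_sum (fun k => v k.+1) (D :\: S).
Proof.
move=> xD; rewrite /partition_sum.
rewrite (partition_big (fun A => finset.pblock A x)
  (fun S : {set T} => (S \subset D) && (x \in S))) /=; last first.
  move=> A pA; have xA : x \in finset.cover A by rewrite (finset.cover_partition pA).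
  by rewrite finset.mem_pblock xA andbT (finset.partitionS pA)// finset.pblock_mem.
apply: eq_bigr => S /andP[SD xS].
have S0 : S != finset.set0 by apply/finset.set0Pn; exists x.
have SDS : S :|: (D :\: S) = D.
  by rewrite finset.setDE finset.setUIr finset.setUCr finset.setIT; apply/finset.setUidPr.
have SnA (A' : {set {set T}}) : finset.partition A' (D :\: S) -> S \notin A'.
  move=> pA'; apply/negP => /(finset.partitionS pA') /fintype.subsetP/(_ x xS).
  by rewrite inE xS.
rewrite (reindex_onto (fun A' => S |: A') (fun A => A :\ S)) /=; last first.
  move=> A /andP[pA /eqP AS]; rewrite finset.setD1K// -AS finset.pblock_mem//.
  by rewrite (finset.cover_partition pA).
rewrite big_distrr/=; apply: eq_big => [A'|A' pA'].
  apply/idP/idP => [/andP[/andP[pA _] /eqP <-]|pA'].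
    by apply: finset.partitionD1 => //; rewrite finset.setU11.
  have pU : finset.partition (S |: A') D.
    rewrite -{1}SDS; apply: finset.partitionU1 => //.
    by apply/pred0P => y; rewrite /= !inE; case: (y \in S).
  rewrite pU finset.setU1K ?SnA// eqxx andbT; apply/eqP.
  by apply: finset.def_pblock => //; [exact: finset.partition_trivIset pU|rewrite finset.setU11].
have SA' : S \notin A'.
  by move: pA' => /andP[/andP[_ _] /eqP <-]; rewrite !inE eqxx.
by rewrite finset.cardsU1 SA' finset.big_setU1//= mulrCA.
Qed.

(** Here i counts the companions of x in S, an arbitrary subset of D minus x. *)
Lemma sum_subsets_with (T : finType) (D : {set T}) x (F : nat -> nat -> R) : x \in D ->
  \sum_(S : {set T} | (S \subset D) && (x \in S)) F #|S| #|D :\: S| =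
  \sum_(i < #|D|) F i.+1 (#|D|.-1 - i)%N *+ 'C(#|D|.-1, i).
Proof.
move=> xD; set m := #|D|.-1.
have cD : #|D| = m.+1 by rewrite /m (finset.cardsD1 x) xD.
have cDx : #|D :\ x| = m by rewrite /m (finset.cardsD1 x D) xD.
rewrite (reindex_onto (fun S => x |: S) (fun S => S :\ x)) /=; last first.
  by move=> S /andP[_ xS]; rewrite finset.setD1K.
rewrite (eq_bigl (fun S : {set T} => S \subset D :\ x)); last first.
  move=> S; rewrite finset.setU11 andbT finset.subUset finset.sub1set xD/=.
  rewrite finset.subsetD1; congr (_ && _).
  apply/eqP/idP => [<-|xS]; first by rewrite !inE eqxx.
  by rewrite finset.setU1K.
rewrite cD (partition_big (fun S : {set T} => inord #|S| : 'I_m.+1) xpredT)//=.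
apply: eq_bigr => i _.
rewrite (eq_bigl (fun S =>
  S \in [set S : {set T} | (S \subset D :\ x) && (#|S| == i)]%SET)); last first.
  move=> S; rewrite !inE; case: (boolP (S \subset _)) => //= /subset_leq_card.
  by rewrite cDx => Sm; rewrite -val_eqE /= inordK.
rewrite (eq_bigr (fun=> F i.+1 (m - i)%N)).
  by rewrite sumr_const cards_draws cDx.
move=> S; rewrite inE => /andP[]; rewrite finset.subsetD1 => /andP[SD xS] /eqP cS.
have xSD : x |: S \subset D by rewrite finset.subUset finset.sub1set xD.
by rewrite finset.cardsD (finset.setIidPr xSD) finset.cardsU1 xS cD cS add1n.
Qed.

End PartitionSums.

(** * Powers of power series *)

Section BinomialSeries.
Context {R : realType}.
Implicit Types (g y : R) (K N M m : nat).

(* Truncation of the binomial series of (1 - y)^{-g}. *)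
Definition binom_poly g K : {poly R} :=
  \poly_(k < K.+1) (rising g k 1 / k`!%:R).

Lemma binom_poly_deriv g K : (binom_poly g K.+1)^`() = g *: binom_poly (g + 1) K.
Proof.
apply/polyP => k; rewrite coef_deriv coefZ !coef_poly ltnS.
case: ifP => _; last by rewrite mul0rn mulr0.
rewrite risingSl factS natrM -mulr_natr.
by field; rewrite nat1r !pnatr_eq0 -lt0n fact_gt0.
Qed.

Lemma binom_poly0 g : binom_poly g 0 = 1.
Proof.
by apply/polyP => k; rewrite coef_poly coef1; case: k => //=; rewrite rising0 fact0 divr1.
Qed.

Lemma horner_binom_polyS g K y :
  (binom_poly g K.+1).[y] = (binom_poly g K).[y] + rising g K.+1 1 / K.+1`!%:R * y ^+ K.+1.
Proof. by rewrite !horner_poly big_ord_recr. Qed.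

Lemma horner_binom_poly0 g y : (binom_poly g 0).[y] = 1.
Proof. by rewrite horner_poly big_ord1 rising0 fact0 divr1 expr0 mulr1. Qed.

(** Truncated form of (1 - y)(1 - y)^{-g-1} = (1 - y)^{-g}; the cut leaves one monomial. *)
Lemma onem_horner_binom_poly g K y : (1 - y) * (binom_poly (g + 1) K).[y] =
  (binom_poly g K).[y] - rising (g + 1) K 1 / K`!%:R * y ^+ K.+1.
Proof.
elim: K => [|K IH]; first by rewrite !horner_binom_poly0 rising0 fact0; field.
rewrite !horner_binom_polyS mulrDr IH (risingSl g) risingS factS natrM !exprS.
by field; rewrite nat1r !pnatr_eq0 -lt0n fact_gt0.
Qed.

Lemma horner_binom_poly_deriv g K y : (binom_poly g K)^`().[y] =
  g * ((binom_poly (g + 1) K).[y] - rising (g + 1) K 1 / K`!%:R * y ^+ K).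
Proof.
case: K => [|K].
  rewrite horner_binom_poly0 rising0 fact0 expr0 divr1 mulr1 subrr mulr0.
  by rewrite binom_poly0 derivC horner0.
by rewrite binom_poly_deriv hornerZ horner_binom_polyS addrK.
Qed.

(** The function is the truncated binomial series divided by its full sum. In its derivative only
    the term at the cut survives; for g > 0 it is nonpositive on [0, 1[, which yields the
    monotonicity and the remainder bound below. *)
Lemma is_derive_binom_powR g K y : y < 1 ->
  is_derive y 1 (fun z => (binom_poly g K).[z] * (1 - z) `^ g)
    (- (g * (rising (g + 1) K 1 / K`!%:R) * y ^+ K * (1 - y) `^ (g - 1))).
Proof.
move=> y1; have y10 : 0 < 1 - y by rewrite subr_gt0.
have Hp : is_derive y 1 (horner (binom_poly g K)) (binom_poly g K)^`().[y].
  by apply: DeriveDef; [exact: derivable_horner|rewrite derivE derive1E].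
have Hs : is_derive y 1 (fun z : R => 1 - z) (-1).
  by apply: is_derive_eq; rewrite add0r mul1r.
have Hq := @is_derive1_comp R (fun u => u `^ g) (fun z => 1 - z) y _ _
  (is_derive1_powR g y10) Hs.
apply: is_derive_eq.
rewrite /GRing.scale /= horner_binom_poly_deriv.
have -> : (1 - y) `^ g = (1 - y) * (1 - y) `^ (g - 1).
  by rewrite powRB ?(gt_eqF y10) ?implybT// powRr1 ?(ltW y10)// mulrC divfK// gt_eqF.
have := onem_horner_binom_poly g K y; rewrite exprS.
by move=> /(canLR (subrK _)) <-; ring.
Qed.

Lemma binom_coef_ge0 g k : 0 < g -> 0 <= rising g k 1 / k`!%:R :> R.
Proof. by move=> g0; rewrite divr_ge0// ltW// rising_gt0. Qed.

Lemma horner_binom_poly_ge g K y : 0 < g -> 0 <= y ->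
  rising g K 1 / K`!%:R * y ^+ K <= (binom_poly g K).[y].
Proof.
move=> g0 y0; rewrite horner_poly big_ord_recr/= lerDr sumr_ge0// => k _.
by rewrite mulr_ge0 ?exprn_ge0 ?binom_coef_ge0.
Qed.

Lemma binom_powR_nincr g K y z : 0 < g -> 0 <= y -> y <= z -> z < 1 ->
  (binom_poly g K).[z] * (1 - z) `^ g <= (binom_poly g K).[y] * (1 - y) `^ g.
Proof.
move=> g0 y0 yz z1; have g10 : 0 < g + 1 by rewrite addr_gt0.
have lt1 x : x \in `[0, z] -> x < 1 by rewrite in_itv/= => /andP[_ /le_lt_trans]; apply.
pose F x := (binom_poly g K).[x] * (1 - x) `^ g.
apply: (@ler0_derive1_nincr _ F 0 z) => // [x|x|].
- move=> /subset_itv_oo_cc/lt1 x1.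
  by apply: ex_derive; exact: is_derive_binom_powR.
- move=> x0z; have x1 := lt1 x (subset_itv_oo_cc x0z).
  rewrite derive1E; have [_ ->] := is_derive_binom_powR g K x1.
  move: x0z; rewrite in_itv/= => /andP[x0 _].
  rewrite oppr_le0 !mulr_ge0 ?powR_ge0 ?exprn_ge0 ?invr_ge0 ?(ltW x0) ?(ltW g0)//.
  by rewrite ltW// rising_gt0.
- apply: derivable_within_continuous => x /lt1 x1.
  by apply: ex_derive; exact: is_derive_binom_powR.
Qed.

Lemma binom_powR_le1 g K y : 0 < g -> 0 <= y < 1 ->
  (binom_poly g K).[y] * (1 - y) `^ g <= 1.
Proof.
move=> g0 /andP[y0 y1]; apply: le_trans (binom_powR_nincr K g0 (lexx 0) y0 y1) _.
rewrite horner_coef0 coef_poly/= rising0 fact0 divr1 mul1r subr0 powR1.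
exact: lexx.
Qed.

(** Mean value theorem on [0, y], where the function starts at 1; at the intermediate point, c^K <=
    y^K and (1 - c)^{g-1} <= 1/(1 - c) <= 1/(1 - y). *)
Lemma binom_powR_ge g K y : 0 < g -> 0 < y < 1 ->
  1 - g * (rising (g + 1) K 1 / K`!%:R * y ^+ K) / (1 - y) <=
  (binom_poly g K).[y] * (1 - y) `^ g.
Proof.
move=> g0 /andP[y0 y1]; have g10 : 0 < g + 1 by rewrite addr_gt0.
pose F x := (binom_poly g K).[x] * (1 - x) `^ g.
have F0 : F 0 = 1.
  by rewrite /F horner_coef0 coef_poly/= rising0 fact0 divr1 mul1r subr0 powR1.
pose dF x := - (g * (rising (g + 1) K 1 / K`!%:R) * x ^+ K * (1 - x) `^ (g - 1)).
have dFP (x : R) : x < 1 -> is_derive x 1 F (dF x) by exact: is_derive_binom_powR.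
have [||c] := @MVT R F dF 0 y y0.
- by move=> x /[!in_itv]/= /andP[_ /lt_trans/(_ y1)]; exact: dFP.
- apply: derivable_within_continuous => x /[!in_itv]/= /andP[_ /le_lt_trans/(_ y1) x1].
  by apply: ex_derive; exact: dFP.
rewrite in_itv/= F0 subr0 -/(F y) => /andP[c0 cy] /(canRL (subrK _)) ->.
rewrite [leRHS]addrC lerD2l /dF mulNr lerN2.
have c1 : 0 < 1 - c by rewrite subr_gt0 (lt_trans cy).
have y10 : 0 < 1 - y by rewrite subr_gt0.
have cg : (1 - c) `^ (g - 1) <= (1 - y)^-1.
  rewrite powRB ?(gt_eqF c1) ?implybT// powRr1 ?(ltW c1)//.
  apply: (@le_trans _ _ (1 - c)^-1).
    rewrite ler_piMl ?invr_ge0 ?(ltW c1)// -[leRHS](powRr0 (1 - c)).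
    by rewrite ger_powR ?(ltW g0)// c1 gerBl ltW.
  by rewrite lef_pV2 ?posrE// lerD2l lerN2 ltW.
rewrite -!mulrA !ler_wpM2l ?invr_ge0 ?(ltW g0) ?(ltW (rising_gt0 _ g10 _))//.
rewrite ler_pM ?exprn_ge0 ?mulr_ge0 ?powR_ge0 ?(ltW c0) ?(ltW y0)//.
  by rewrite lerXn2r ?nnegrE ?(ltW c0) ?(ltW y0)// ltW.
by rewrite (le_trans _ cg)// ler_piMr ?powR_ge0 ?(ltW y1).
Qed.

(** At a point z between y and 1 each term is at most the truncated sum, hence at most (1 - z)^{-g};
    the factor (y/z)^K remains. *)
Lemma cvg_binom_coef_expr g y : 0 < g -> 0 < y < 1 ->
  rising g K 1 / K`!%:R * y ^+ K @[K --> \oo] --> 0.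
Proof.
move=> g0 /andP[y0 y1]; pose z := (1 + y) / 2.
have [yz z1] : y < z /\ z < 1 by rewrite /z; split; lra.
have z0 : 0 < z by apply: lt_trans yz.
have z10 : 0 < 1 - z by rewrite subr_gt0.
pose C := ((1 - z) `^ g)^-1.
have bound K : rising g K 1 / K`!%:R * z ^+ K <= C.
  apply: le_trans (horner_binom_poly_ge K g0 (ltW z0)) _.
  by rewrite -[leLHS]mulr1 -[leRHS]mul1r ler_pdivlMr ?powR_gt0// mulr1
    binom_powR_le1// (ltW z0).
apply: (@squeeze_cvgr _ _ _ _ (fun=> 0) (fun K => C * (y / z) ^+ K)).
- apply: nearW => K; rewrite mulr_ge0 ?binom_coef_ge0 ?exprn_ge0 ?(ltW y0)//=.
  by rewrite expr_div_n mulrA ler_pdivlMr ?exprn_gt0// mulrAC ler_wpM2r// exprn_ge0 ?ltW.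
- exact: cvg_cst.
- rewrite -(mulr0 C); apply: cvgMr; apply: cvg_expr.
  rewrite ger0_norm; last by rewrite divr_ge0 ?ltW.
  by rewrite ltr_pdivrMr// mul1r.
Qed.

(** By monotonicity in y, a degree K that works at the worst point y0 works on all of [0, y0]. *)
Lemma binom_powR_uniform g y0 (e : R) : 0 < g -> 0 < y0 < 1 -> 0 < e ->
  exists K, forall y, 0 <= y <= y0 -> 1 - e <= (binom_poly g K).[y] * (1 - y) `^ g.
Proof.
move=> g0 /andP[y0_gt0 y01] e0; have g10 : 0 < g + 1 by rewrite addr_gt0.
have lim0 : g * (rising (g + 1) K 1 / K`!%:R * y0 ^+ K) / (1 - y0) @[K --> \oo] --> 0.
  have <- : g * 0 / (1 - y0) = 0 by rewrite mulr0 mul0r.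
  by apply: cvgMl; apply: cvgMr; apply: cvg_binom_coef_expr => //; rewrite y0_gt0.
have /cvgr_lt/(_ e e0)[K _ /(_ K (leqnn K)) HK] := lim0.
exists K => y /andP[y_ge0 yy0]; apply: le_trans (binom_powR_nincr K g0 y_ge0 yy0 y01).
apply: le_trans (binom_powR_ge K g0 _); last by rewrite y0_gt0.
by rewrite lerD2l lerN2 ltW.
Qed.

(** * Coefficients of (1 - q(x))^{-g} *)

Section PowerComposition.
Context (q : nat -> R).
Hypotheses (q0 : q 0%N = 0) (q_ge0 : forall j, 0 <= q j).

(* [comp_coef g m] is the coefficient of x^m in (1 - q(x))^{-g}: truncating both
   series at m does not affect it because [q 0 = 0]. *)
Definition comp_poly_trunc g K N : {poly R} := binom_poly g K \Po \poly_(j < N.+1) q j.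

Definition comp_coef g m : R := (comp_poly_trunc g m m)`_m.

Lemma comp_trunc_coef0 g K N : (comp_poly_trunc g K N)`_0 = 1.
Proof.
rewrite -horner_coef0 horner_comp horner_coef0 coef_poly/= q0 horner_coef0 coef_poly/=.
by rewrite rising0 fact0 divr1.
Qed.

(** The coefficient of x^m in the chain rule; differentiating the outer polynomial turns g into g +
    1 and lowers its degree bound by one. *)
Lemma comp_trunc_coefS g K N m : (comp_poly_trunc g K.+1 N)`_m.+1 *+ m.+1 =
  g * \sum_(i < m.+1) (q i.+1 *+ (i < N)%N *+ i.+1 * (comp_poly_trunc (g + 1) K N)`_(m - i)).
Proof.
rewrite -coef_deriv deriv_comp binom_poly_deriv comp_polyZ -scalerAl coefZ.
rewrite (mulrC (_ \Po _)) coefM; congr (_ * _); apply: eq_bigr => i _.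
by rewrite coef_deriv coef_poly ltnS; case: ifP; rewrite ?mulr0n.
Qed.

(** Strong induction on m with g free: the recursion expresses coefficient m + 1 through
    coefficients of index at most m for g + 1. *)
Lemma comp_trunc_stable g K N m : (m <= K)%N -> (m <= N)%N ->
  (comp_poly_trunc g K N)`_m = comp_coef g m.
Proof.
rewrite /comp_coef.
elim/ltn_ind: m g K N => -[|m] IH g [|K] N//; rewrite ?comp_trunc_coef0//.
move=> mK mN; apply: (@mulIf _ m.+1%:R); first by rewrite pnatr_eq0.
rewrite !mulr_natr !comp_trunc_coefS; congr (_ * _); apply: eq_bigr => i _.
have im : (m - i <= m)%N by rewrite leq_subr.
rewrite (leq_trans (ltn_ord i) mN) (ltn_ord i) IH// ?(leq_trans im)// ?(ltnW mN)//.
by rewrite [in RHS]IH// ltnW.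
Qed.

Lemma comp_coef0 g : comp_coef g 0 = 1.
Proof. exact: comp_trunc_coef0. Qed.

(** This recursion mirrors the removal of the block of a fixed element, and it also drives the bound
    on m h_m. *)
Lemma comp_coefS g m : m.+1%:R * comp_coef g m.+1 =
  g * \sum_(i < m.+1) (i.+1%:R * q i.+1 * comp_coef (g + 1) (m - i)).
Proof.
rewrite mulr_natl /comp_coef comp_trunc_coefS; congr (_ * _); apply: eq_bigr => i _.
have im : (m - i <= m)%N by rewrite leq_subr.
by rewrite ltn_ord mulr1n comp_trunc_stable ?(leq_trans im)// mulr_natl.
Qed.

(** Truncating either series only discards nonnegative contributions, by induction through the
    recursion. *)
Lemma comp_trunc_bounds g K N m : 0 <= g ->
  0 <= (comp_poly_trunc g K N)`_m <= comp_coef g m.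
Proof.
elim/ltn_ind: m g K N => -[|m] IH g K N g0.
  by rewrite comp_trunc_coef0 comp_coef0 ler01 lexx.
have g10 : 0 <= g + 1 by rewrite addr_ge0.
have m0 : (0 : R) < m.+1%:R by [].
have cge0 i : (i <= m)%N -> 0 <= comp_coef (g + 1) i.
  by move=> im; have /andP[/le_trans + h] := IH i im (g + 1) i i g10; exact.
have q1 i : 0 <= i.+1%:R * q i.+1 by rewrite mulr_ge0.
have rhs0 : 0 <= comp_coef g m.+1.
  rewrite -(pmulr_rge0 _ m0) comp_coefS mulr_ge0// sumr_ge0// => i _.
  by rewrite mulr_ge0// cge0// leq_subr.
case: K => [|K].
  by rewrite /comp_poly_trunc binom_poly0 -(polyC1 R) comp_polyC coefC/= lexx.
rewrite -(pmulr_rge0 _ m0) -(ler_pM2l m0 _ (comp_coef _ _)) comp_coefS mulr_natl comp_trunc_coefS.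
apply/andP; split.
  rewrite mulr_ge0// sumr_ge0// => i _; rewrite mulr_ge0 ?mulrn_wge0//.
  by have /andP[] := IH (m - i)%N (leq_subr _ _) (g + 1) K N g10.
rewrite ler_wpM2l// ler_sum// => i _.
have /andP[c0 c1] := IH (m - i)%N (leq_subr _ _) (g + 1) K N g10.
rewrite -[_ *+ i.+1]mulr_natl ler_pM// ?mulr_ge0 ?mulrn_wge0// ler_wpM2l//.
by case: (i < N)%N; rewrite ?mulr1n ?mulr0n.
Qed.

Lemma comp_coef_ge0 g m : 0 <= g -> 0 <= comp_coef g m.
Proof. by move=> /(comp_trunc_bounds m m m)/andP[/le_trans]; apply. Qed.

Let horner1_q N : (\poly_(j < N.+1) q j).[1] = \sum_(j < N.+1) q j.
Proof. by rewrite horner_poly; apply: eq_bigr => j _; rewrite expr1n mulr1. Qed.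

(** Evaluation of the truncated composition at x = 1: its coefficients are exact up to degree M and
    nonnegative beyond. *)
Lemma sum_comp_coef_le g M : 0 <= g ->
  \sum_(m < M.+1) comp_coef g m <= (binom_poly g M).[\sum_(j < M.+1) q j].
Proof.
move=> g0; rewrite -horner1_q -horner_comp -/(comp_poly_trunc g M M).
set p := comp_poly_trunc g M M.
rewrite (@horner_coef_wide _ (maxn (size p) M.+1)) ?leq_maxl//.
under [leRHS]eq_bigr do rewrite expr1n mulr1.
rewrite -(subnKC (leq_maxr (size p) M.+1)) big_split_ord/=.
rewrite -[leLHS]addr0 lerD//.
  by rewrite ler_sum// => m _; rewrite comp_trunc_stable// -ltnS.
by rewrite sumr_ge0// => i _; have /andP[] := comp_trunc_bounds M M (M.+1 + i) g0.
Qed.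

(** The truncated composition has degree at most K N, so the sum up to M covers all its
    coefficients, each at most h_m. *)
Lemma sum_comp_coef_ge g K N M : 0 <= g -> (K * N <= M)%N ->
  (binom_poly g K).[\sum_(j < N.+1) q j] <= \sum_(m < M.+1) comp_coef g m.
Proof.
move=> g0 KNM; rewrite -horner1_q -horner_comp -/(comp_poly_trunc g K N).
rewrite (@horner_coef_wide _ M.+1).
  rewrite ler_sum// => m _; rewrite expr1n mulr1.
  by have /andP[] := comp_trunc_bounds K N m g0.
rewrite (leq_trans (size_comp_poly_leq _ _))// ltnS (leq_trans _ KNM)//.
have sz n (F : nat -> R) : ((size (\poly_(j < n.+1) F j)).-1 <= n)%N.
  by have := size_poly n.+1 F; case: size.
exact: leq_mul (sz _ _) (sz _ _).
Qed.

End PowerComposition.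

End BinomialSeries.

(** * Estimates uniform in the minimal block size *)

Lemma cvg_powR (R : realType) (T : Type) (F : set_system T) {FF : Filter F}
    (f : T -> R) (l a : R) : 0 < l -> f @ F --> l -> f x `^ a @[x --> F] --> l `^ a.
Proof.
move=> l0; apply: (@continuous_cvg _ _ _ F FF f (fun x => x `^ a)).
apply: differentiable_continuous.
by apply/derivable1_diffP; apply: ex_derive; exact: is_derive1_powR.
Qed.

Lemma powR_inv (R : realType) (x a : R) : 0 <= x -> x^-1 `^ a = (x `^ a)^-1.
Proof. by move=> x0; rewrite -powR_inv1// -powRrM mulN1r powRN. Qed.

Section UniformEstimates.
Context {R : realType} (alpha : R).
Hypotheses (alpha_gt0 : 0 < alpha) (alpha_lt1 : alpha < 1).
Implicit Types (g e : R) (r m M N : nat).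

(* The tail sum of [p_alpha alpha j] over j > N, see [sum_p_alpha]; locked because
   [rewrite] would otherwise match [_ * _] inside [tail N]. *)
Definition tail N : R := locked (rising (1 - alpha) N 1 / N`!%:R).

Lemma tailE N : tail N = rising (1 - alpha) N 1 / N`!%:R.
Proof. by rewrite /tail -lock. Qed.

Definition p_tail r j : R := p_alpha alpha j *+ (r <= j)%N.

Let onem_gt0 : 0 < 1 - alpha. Proof. by rewrite subr_gt0. Qed.

Let fact_neq0 N : N`!%:R != 0 :> R. Proof. by rewrite pnatr_eq0 -lt0n fact_gt0. Qed.

Lemma tail0 : tail 0 = 1.
Proof. by rewrite !tailE rising0 fact0 divr1. Qed.

Lemma tailS N : N.+1%:R * tail N.+1 = (N.+1%:R - alpha) * tail N.
Proof.
rewrite !tailE risingS factS natrM; field.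
by rewrite fact_neq0 nat1r pnatr_eq0.
Qed.

Lemma tail_gt0 N : 0 < tail N.
Proof. by rewrite tailE divr_gt0 ?rising_gt0// ltr0n fact_gt0. Qed.

(** Absorption identity for the binomial coefficient. It trades the size-biased sequence for the
    monotone [tail] in all later estimates. *)
Lemma p_alpha_tail j : j.+1%:R * p_alpha alpha j.+1 = alpha * tail j.
Proof.
rewrite /p_alpha /gen_binom tailE factS natrM big_ord_recl subr0.
have -> : \prod_(i < j) (alpha - (lift ord0 i)%:R) = (-1) ^+ j * rising (1 - alpha) j 1.
  rewrite /rising -[in (-1) ^+ j](card_ord j) -prodrN; apply: eq_bigr => i _.
  by rewrite lift0 -nat1r; ring.
rewrite exprS exprS; have : ((-1) ^+ j * (-1) ^+ j : R) = 1 by rewrite -expr2 sqrr_sign.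
set sg := (-1) ^+ j => sg2.
transitivity (alpha * (rising (1 - alpha) j 1 / j`!%:R) * (sg * sg)); last by rewrite sg2 mulr1.
by field; rewrite fact_neq0 nat1r pnatr_eq0.
Qed.

Lemma tail_diff N : tail N - tail N.+1 = p_alpha alpha N.+1.
Proof.
have N0 : N.+1%:R != 0 :> R by rewrite pnatr_eq0.
by apply: (mulfI N0); rewrite mulrBr tailS p_alpha_tail; ring.
Qed.

Lemma p_alpha_gt0 j : 0 < p_alpha alpha j.+1.
Proof. by rewrite -(pmulr_rgt0 _ (ltr0Sn R j)) p_alpha_tail mulr_gt0// tail_gt0. Qed.

Lemma tail_nincr : {homo tail : m n / (m <= n)%N >-> n <= m}.
Proof.
apply/nonincreasing_seqP => n.
by rewrite -subr_ge0 tail_diff ltW// p_alpha_gt0.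
Qed.

(** The sequence n [tail n] is nondecreasing, as (n + 1) [tail n.+1] = (n + 1 - alpha) [tail n] and
    alpha < 1; this expresses that [tail] decreases slowly. *)
Lemma tail_le m n : (n - m)%:R * tail (n - m) <= n%:R * tail n.
Proof.
suff: {homo (fun n => n%:R * tail n) : m n / (m <= n)%N >-> m <= n}.
  by apply; rewrite leq_subr.
apply/nondecreasing_seqP => k.
by rewrite tailS ler_wpM2r ?(ltW (tail_gt0 _))// -natr1 -addrA lerDl subr_ge0 ltW.
Qed.

Lemma sum_tail N : \sum_(i < N.+1) tail i = tail N * (N.+1%:R - alpha) / (1 - alpha).
Proof.
elim: N => [|N IH]; first by rewrite big_ord1 mulfK ?gt_eqF.
rewrite big_ord_recr/= IH.
have -> : tail N = N.+1%:R * tail N.+1 / (N.+1%:R - alpha).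
  rewrite tailS mulrAC divff ?mul1r// gt_eqF// subr_gt0 (lt_le_trans alpha_lt1)//.
  by rewrite ler1n.
field; rewrite nat1r !gt_eqF// ?subr_gt0// (lt_le_trans alpha_lt1)//.
by rewrite ler1n.
Qed.

(** [tail N] is (N + 1)^{-alpha} divided by Euler's quotient at 1 - alpha. *)
Lemma cvg_tail : tail N @[N --> \oo] --> 0.
Proof.
have GN : Gamma (1 - alpha) != 0 by rewrite gt_eqF// Gamma_gt0.
have lim : (N`!%:R * N.+1%:R `^ (1 - alpha - 1) / rising (1 - alpha) N 1)^-1
    @[N --> \oo] --> (Gamma (1 - alpha))^-1.
  by apply: cvgV => //; exact: Gamma_limit.
rewrite (_ : tail = fun N => harmonic N `^ alpha *
    (N`!%:R * N.+1%:R `^ (1 - alpha - 1) / rising (1 - alpha) N 1)^-1).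
  rewrite -(mul0r (Gamma (1 - alpha))^-1); apply: cvgM lim.
  have /cvg_at_rightP := powR_cvg0 alpha_gt0; apply; split.
    by move=> n; rewrite /harmonic /= invr_gt0.
  exact: cvg_harmonic.
apply/funext => N; rewrite /harmonic /= addrAC subrr add0r powRN.
rewrite powR_inv//.
have p0 : N.+1%:R `^ alpha != 0 :> R by rewrite gt_eqF// powR_gt0.
by rewrite tailE; field; rewrite p0 fact_neq0 gt_eqF// rising_gt0.
Qed.

Lemma p_tail0 r : (0 < r)%N -> p_tail r 0 = 0.
Proof. by rewrite /p_tail leqn0 lt0n => /negbTE ->. Qed.

Lemma p_tail_ge0 r j : (0 < r)%N -> 0 <= p_tail r j.
Proof.
case: j => [r0|j _]; first by rewrite p_tail0.
by rewrite mulrn_wge0// ltW// p_alpha_gt0.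
Qed.

Lemma sum_p_alpha N : \sum_(1 <= j < N.+1) p_alpha alpha j = 1 - tail N.
Proof.
elim: N => [|N IH]; first by rewrite big_geq// tail0 subrr.
by rewrite big_nat_recr//= IH -tail_diff; ring.
Qed.

(** Telescoping of [tail_diff]; the maximum with 0 covers N < r. *)
Lemma sum_p_tail r N : (0 < r)%N ->
  \sum_(j < N.+1) p_tail r j = Num.max 0 (tail r.-1 - tail N).
Proof.
case: r => // r _; elim: N => [|N IH].
  rewrite big_ord1 p_tail0// tail0 max_l// subr_le0 -tail0.
  exact: tail_nincr.
rewrite big_ord_recr/= IH /p_tail -tail_diff ltnS.
have [rN|Nr] := leqP r N.
  have := tail_nincr rN; have := tail_nincr (leqnSn N) => h1 h2.
  by rewrite !max_r ?subr_ge0// ?(le_trans h1)// mulr1n; ring.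
rewrite addr0 !max_l// subr_le0; apply: tail_nincr => //.
exact: ltnW.
Qed.

(** Here r >= 2 enters: the total mass of q is at most [tail 1] = 1 - alpha, so it stays away from 1
    uniformly in r. *)
Lemma tail_bounds r : (1 < r)%N -> 0 < tail r.-1 <= 1 - alpha.
Proof.
case: r => [|[|r]]//= _; rewrite tail_gt0/=.
apply: le_trans (tail_nincr (_ : 1 <= r.+1)%N) _ => //.
by rewrite !tailE risingS rising0 divr1 mul1r mul0r addr0.
Qed.

Lemma sum_comp_coef_tail_le g r M : 0 < g -> (1 < r)%N ->
  (1 - tail r.-1) `^ g * \sum_(m < M.+1) comp_coef (p_tail r) g m <= 1.
Proof.
move=> g0 r1; have r0 : (0 < r)%N by apply: ltnW.
have /andP[t0 t1] := tail_bounds r1.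
set y := \sum_(j < M.+1) p_tail r j.
have y0 : 0 <= y by rewrite /y sum_p_tail// le_max lexx.
have yt : y <= tail r.-1.
  by rewrite /y sum_p_tail// ge_max (ltW t0) gerBl ltW// tail_gt0.
have y1 : y < 1 by rewrite (le_lt_trans yt)// (le_lt_trans t1)// gtrBl.
apply: le_trans (binom_powR_le1 M g0 (_ : 0 <= y < 1)); last by rewrite y0.
rewrite mulrC ler_pM ?powR_ge0 ?sumr_ge0//.
- by move=> i _; apply: comp_coef_ge0 => // [|j|]; rewrite ?p_tail0 ?p_tail_ge0// ltW.
- apply: sum_comp_coef_le => // [|j|]; rewrite ?p_tail0 ?p_tail_ge0// ltW//.
- by rewrite ge0_ler_powR ?nnegrE ?(ltW g0)// ?lerD2l ?lerN2// subr_ge0 ?(ltW y1)//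
    (le_trans t1)// gerBl ltW.
Qed.

(** Both cuts are chosen independently of r: K from the uniform binomial bound on [0, 1 - alpha], N
    from the decay of [tail]. *)
Lemma sum_comp_coef_tail_ge g e : 0 < g -> 0 < e ->
  exists M0, forall M r, (M0 <= M)%N -> (1 < r)%N ->
  1 - e <= (1 - tail r.-1) `^ g * \sum_(m < M.+1) comp_coef (p_tail r) g m.
Proof.
move=> g0 e0; have e20 : 0 < e / 2 by rewrite divr_gt0.
have a01 : 0 < 1 - alpha < 1 by rewrite onem_gt0 gtrBl.
have [K HK] := binom_powR_uniform g0 a01 e20.
(* This quotient bounds (1 - [tail r.-1])/(1 - y) from below, since y >= [tail r.-1] - [tail N] and
   1 - [tail r.-1] >= alpha. *)
have lim1 : (alpha / (alpha + tail N)) `^ g @[N --> \oo] --> (1 `^ g : R).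
  apply: (@cvg_powR R nat \oo _ (fun N => alpha / (alpha + tail N))) => //.
  have a0 : alpha != 0 by rewrite gt_eqF.
  rewrite -[X in _ --> X](divff a0); apply: cvgMr; apply: cvgV => //.
  rewrite -[X in _ --> X]addr0; apply: cvgD cvg_tail; exact: cvg_cst.
have /cvgr_gt/(_ (1 - e / 2)) := lim1; rewrite powR1 gtrBl => /(_ e20)[N _ /(_ N (leqnn N))/= HN].
exists (K * N)%N => M r KNM r1; have r0 : (0 < r)%N by apply: ltnW.
have /andP[t0 t1] := tail_bounds r1.
set y := \sum_(j < N.+1) p_tail r j.
have yE : y = Num.max 0 (tail r.-1 - tail N) by rewrite /y sum_p_tail.
have y0 : 0 <= y by rewrite yE le_max lexx.
have yt : y <= tail r.-1 by rewrite yE ge_max (ltW t0) gerBl ltW// tail_gt0.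
have ty : tail r.-1 - tail N <= y by rewrite yE le_max lexx orbT.
have SM : (binom_poly g K).[y] <= \sum_(m < M.+1) comp_coef (p_tail r) g m.
  by apply: sum_comp_coef_ge => // [|j|]; rewrite ?p_tail0 ?p_tail_ge0// ltW.
clearbody y; have y1 : 0 < 1 - y by lra.
have := HK y; rewrite y0 (le_trans yt t1) => /(_ isT) a1.
have a2 : (binom_poly g K).[y] * (1 - y) `^ g <= 1 by rewrite binom_powR_le1 ?y0//; lra.
have tN := tail_gt0 N.
have b2 : ((1 - tail r.-1) / (1 - y)) `^ g <= 1.
  apply: (@le_trans _ _ (1 `^ g)); last by rewrite powR1.
  rewrite ge0_ler_powR ?nnegrE ?(ltW g0)//.
    by rewrite divr_ge0//; lra.
  by rewrite ler_pdivrMr// mul1r; lra.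
have b1 : 1 - e / 2 <= ((1 - tail r.-1) / (1 - y)) `^ g.
  rewrite (le_trans (ltW HN))// ge0_ler_powR ?nnegrE ?(ltW g0)//.
  - by rewrite divr_ge0//; lra.
  - by rewrite divr_ge0//; lra.
  - rewrite ler_pdivlMr// mulrAC ler_pdivrMr; last by lra.
    nra.
have -> : (1 - tail r.-1) `^ g = ((1 - tail r.-1) / (1 - y)) `^ g * (1 - y) `^ g.
  by rewrite -powRM ?divfK ?gt_eqF// ?divr_ge0//; lra.
set a := _ * (1 - y) `^ g in a1 a2; set b := _ `^ g in b1 b2.
(* As a and b are at most 1, a b >= a + b - 1 >= 1 - e. *)
apply: (@le_trans _ _ (b * a)); first nra.
by rewrite -/b /a mulrA mulrAC ler_wpM2l ?mulr_ge0 ?powR_ge0.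
Qed.


Lemma comp_coef_p_tail_ge0 g r m : 0 < g -> (0 < r)%N -> 0 <= comp_coef (p_tail r) g m.
Proof.
by move=> g0 r0; apply: comp_coef_ge0 => // [|j|]; rewrite ?p_tail0 ?p_tail_ge0// ltW.
Qed.

Lemma size_biased_p_tail_le r i : i.+1%:R * p_tail r i.+1 <= alpha * tail i.
Proof.
rewrite -p_alpha_tail ler_wpM2l// /p_tail.
by case: (r <= i.+1)%N; rewrite ?mulr1n ?mulr0n// ltW// p_alpha_gt0.
Qed.

Lemma powR_tail_ge g r : 0 < g -> (1 < r)%N -> alpha `^ g <= (1 - tail r.-1) `^ g <= 1.
Proof.
move=> g0 r1; have /andP[t0 t1] := tail_bounds r1.
have ta : alpha <= 1 - tail r.-1 by rewrite lerBrDl -lerBrDr.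
apply/andP; split.
  by rewrite ge0_ler_powR ?nnegrE ?(ltW g0) ?(ltW alpha_gt0) ?(le_trans _ ta)// ltW.
apply: (@le_trans _ _ (1 `^ g)); last by rewrite powR1.
by rewrite ge0_ler_powR ?nnegrE ?(ltW g0) ?gerBl ?(ltW t0) ?(le_trans _ ta)// ltW.
Qed.

(* In m h_m = g sum_l (m-l) q_(m-l) h'_l, where h' has exponent g + 1, the factor
   (m-l) q_(m-l) is small for l <= m/2 and the tail of sum h' is small for l > m/2. *)
Lemma size_biased_comp_coef_small g e : 0 < g -> 0 < e ->
  exists M0, forall m r, (M0 <= m)%N -> (1 < r)%N -> m%:R * comp_coef (p_tail r) g m <= e.
Proof.
move=> g0 e0; have g10 : 0 < g + 1 by rewrite addr_gt0.
pose A := alpha `^ (g + 1).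
have A0 : 0 < A by rewrite powR_gt0.
(* Each half of the convolution will be at most alpha d/A, and g times their sum is then e. *)
pose d := e * A / (g * (alpha + alpha)).
have d0 : 0 < d by rewrite divr_gt0 ?mulr_gt0 ?addr_gt0.
have [M0 HM] := sum_comp_coef_tail_ge g10 d0.
have /cvgr_lt/(_ d d0)[N0 _ HN] := cvg_tail.
exists (M0 + N0).*2.+1 => -[//|m] r mM r1; have r0 : (0 < r)%N by apply: ltnW.
pose t := m./2.
have tM : (M0 + N0 <= t)%N by rewrite /t; lia.
have tm : (t <= m)%N by rewrite /t; lia.
have tmt : (t <= m - t)%N by rewrite /t; lia.
pose G i := comp_coef (p_tail r) (g + 1) i.
have G_ge0 i : 0 <= G i by exact: comp_coef_p_tail_ge0.
have S1 M : \sum_(i < M.+1) G i <= A^-1.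
  rewrite -[leRHS]mul1r ler_pdivlMr// mulrC.
  apply: le_trans (sum_comp_coef_tail_le M g10 r1).
  by rewrite ler_wpM2r ?sumr_ge0//; have /andP[] := powR_tail_ge g10 r1.
(* The weighted sum is at most 1 and its first t + 1 terms already reach 1 - d. *)
have S2 : \sum_(t.+1 <= i < m.+1) G i <= d / A.
  have H1 := sum_comp_coef_tail_le m g10 r1.
  have H2 := HM t r (leq_trans (leq_addr _ _) tM) r1.
  rewrite ler_pdivlMr// mulrC.
  apply: (@le_trans _ _ ((1 - tail r.-1) `^ (g + 1) * \sum_(t.+1 <= i < m.+1) G i)).
    by rewrite ler_wpM2r ?sumr_ge0//; have /andP[] := powR_tail_ge g10 r1.
  move: H1 H2; rewrite -(big_mkord xpredT G) -(big_mkord xpredT G).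
  rewrite (@big_cat_nat _ _ _ t.+1 0 m.+1)//= mulrDr.
  lra.
rewrite comp_coefS ?p_tail0//.
have -> : \sum_(i < m.+1) i.+1%:R * p_tail r i.+1 * comp_coef (p_tail r) (g + 1) (m - i) =
    \sum_(0 <= i < m.+1) (m - i).+1%:R * p_tail r (m - i).+1 * G i.
  rewrite (big_mkord xpredT (fun i => (m - i).+1%:R * p_tail r (m - i).+1 * G i)).
  rewrite (reindex_inj rev_ord_inj)/=; apply: eq_bigr => i _.
  by rewrite /G subSS subKn// -ltnS.
rewrite (@big_cat_nat _ _ _ t.+1 0 m.+1)//=.
have B1 : \sum_(0 <= i < t.+1) (m - i).+1%:R * p_tail r (m - i).+1 * G i <= alpha * d / A.
  apply: (@le_trans _ _ (alpha * d * \sum_(i < t.+1) G i)); last first.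
    by rewrite ler_wpM2l// mulr_ge0 ?ltW.
  rewrite big_mkord mulr_sumr ler_sum// => i _; rewrite ler_wpM2r//.
  apply: le_trans (size_biased_p_tail_le _ _) _; rewrite ler_wpM2l ?(ltW alpha_gt0)//.
  by apply/ltW/HN => /=; have := ltn_ord i; lia.
have B2 : \sum_(t.+1 <= i < m.+1) (m - i).+1%:R * p_tail r (m - i).+1 * G i <= alpha * d / A.
  apply: (@le_trans _ _ (alpha * \sum_(t.+1 <= i < m.+1) G i)).
    rewrite mulr_sumr ler_sum_nat// => i _; rewrite ler_wpM2r//.
    apply: le_trans (size_biased_p_tail_le _ _) _.
    by rewrite ler_piMr ?(ltW alpha_gt0)// -tail0 tail_nincr.
  by rewrite -mulrA ler_wpM2l// ltW.
apply: (@le_trans _ _ (g * (alpha * d / A + alpha * d / A))).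
  by rewrite ler_wpM2l ?(ltW g0)// lerD.
rewrite le_eqVlt; apply/orP; left; apply/eqP; rewrite /d; field.
by rewrite !gt_eqF ?addr_gt0.
Qed.

(* The index [i.+1] is the size of the block containing a fixed element. *)
Definition first_block_sum r g N : R :=
  \sum_(i < N.+1) i.+1%:R * p_tail r i.+1 * comp_coef (p_tail r) g (N - i).

Lemma first_block_sum_rev r g N : first_block_sum r g N =
  \sum_(0 <= l < N.+1) (N - l).+1%:R * p_tail r (N - l).+1 * comp_coef (p_tail r) g l.
Proof.
rewrite (big_mkord xpredT
  (fun l => (N - l).+1%:R * p_tail r (N - l).+1 * comp_coef (p_tail r) g l)).
rewrite /first_block_sum (reindex_inj rev_ord_inj)/=; apply: eq_bigr => i _.
by rewrite subSS subKn// -ltnS.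
Qed.

(** Only l <= N + 1 - r is kept: there the block size N - l + 1 is at least r, and [tail (N - l)] >=
    [tail N]. *)
Lemma first_block_sum_ge r g N : 0 < g -> (0 < r)%N -> (r <= N.+1)%N ->
  alpha * tail N * \sum_(l < (N.+1 - r).+1) comp_coef (p_tail r) g l <= first_block_sum r g N.
Proof.
move=> g0 r0 rN; rewrite first_block_sum_rev.
have NrN : ((N.+1 - r).+1 <= N.+1)%N by lia.
rewrite (@big_cat_nat _ _ _ (N.+1 - r).+1 0 N.+1)//= -[leLHS]addr0 lerD//; last first.
  by rewrite sumr_ge0// => i _; rewrite !mulr_ge0 ?p_tail_ge0 ?comp_coef_p_tail_ge0.
rewrite big_mkord mulr_sumr ler_sum// => l _.
rewrite ler_wpM2r ?comp_coef_p_tail_ge0//.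
have rl : (r <= (N - l).+1)%N.
  by have := ltn_ord l; lia.
rewrite /p_tail rl mulr1n p_alpha_tail ler_wpM2l ?(ltW alpha_gt0)// tail_nincr//.
exact: leq_subr.
Qed.


(* For l <= N/2 one has tail (N-l) <= tail N (1 + 2 l/N), and l h_l is small on average;
   for l > N/2 one has h_l <= 2e/N, while sum_{i<=N} tail i is of order N tail N. *)
Lemma first_block_sum_le r g e N M0 : 0 < g -> (1 < r)%N -> 0 <= e ->
  (forall m, (M0 <= m)%N -> m%:R * comp_coef (p_tail r) g m <= e) ->
  (M0.*2 < N)%N ->
  first_block_sum r g N * (1 - tail r.-1) `^ g <=
  alpha * tail N * (1 + 2 * M0%:R / N%:R + 4 * e + 4 * e / (1 - alpha)).
Proof.
move=> g0 r1 e0 He MN; have r0 : (0 < r)%N by apply: ltnW.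
have N0 : (0 : R) < N%:R by rewrite ltr0n; case: N MN.
have N1 : (1 : R) <= N%:R by rewrite ler1n; case: N MN {N0}.
pose t := N./2; pose h l := comp_coef (p_tail r) g l.
have h0 l : 0 <= h l by exact: comp_coef_p_tail_ge0.
have tN : (t <= N)%N by rewrite /t; clear; lia.
have /andP[s0 s1] := powR_tail_ge g0 r1.
have {}s0 : 0 < (1 - tail r.-1) `^ g by rewrite (lt_le_trans _ s0)// powR_gt0.
set s := (1 - tail r.-1) `^ g in s0 s1 *.
have aN : 0 <= alpha * tail N by rewrite mulr_ge0 ?ltW// tail_gt0.
(* Below M0 the factor l is bounded by M0, above it the hypothesis applies. *)
have lh l : l%:R * h l <= M0%:R * h l + e.
  have [lM|Ml] := ltnP l M0; last by rewrite ler_wpDl ?mulr_ge0// He.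
  by rewrite ler_wpDr// ler_wpM2r// ler_nat ltnW.
rewrite first_block_sum_rev (@big_cat_nat _ _ _ t.+1 0 N.+1)//= mulrDl.
have B1 : \sum_(0 <= l < t.+1) (N - l).+1%:R * p_tail r (N - l).+1 * h l <=
    alpha * tail N * ((1 + 2 * M0%:R / N%:R) * \sum_(0 <= l < t.+1) h l + 4 * e).
  have -> : alpha * tail N * ((1 + 2 * M0%:R / N%:R) * \sum_(0 <= l < t.+1) h l + 4 * e) =
      alpha * tail N * ((1 + 2 * M0%:R / N%:R) * \sum_(0 <= l < t.+1) h l) +
      alpha * tail N * (4 * e) by rewrite mulrDr.
  apply: (@le_trans _ _ (\sum_(0 <= l < t.+1)
      (alpha * tail N * ((1 + 2 * M0%:R / N%:R) * h l) + alpha * tail N * (2 * e / N%:R)))).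
    rewrite ler_sum_nat// => l /andP[_ lt].
    apply: le_trans (ler_wpM2r (h0 l) (size_biased_p_tail_le _ _)) _.
    rewrite -!mulrA -mulrDr ler_wpM2l ?(ltW alpha_gt0)//.
    have lN : (l <= N)%N by rewrite (leq_trans _ tN).
    have Nl2 : N%:R <= 2 * (N - l)%:R :> R.
      by rewrite -natrM ler_nat; move: lt; rewrite /t; clear; lia.
    have := tail_le l N; rewrite natrB//; rewrite natrB// in Nl2.
    have := lh l; have := h0 l; have := tail_gt0 N; have := tail_gt0 (N - l).
    move: (tail (N - l)) (tail N) (h l) => T1 T2 H T10 T20 H0 LH TL.
    have -> : T2 * ((1 + 2 * (M0%:R / N%:R)) * H) + T2 * (2 * (e / N%:R)) =
      T2 * H + T2 * (2 / N%:R * (M0%:R * H + e)) by field; rewrite gt_eqF.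
    apply: (@le_trans _ _ (T2 * H + T2 * (2 / N%:R * (l%:R * H)))); last first.
      by rewrite lerD2l ler_wpM2l ?(ltW T20)// ler_wpM2l// divr_ge0// ltW.
    rewrite !mulrA -mulrDl ler_wpM2r//.
    (* From [tail_le]; then N <= 2(N - l) gives N/(N - l) <= 1 + 2l/N. *)
    have T1le : T1 <= T2 * N%:R / (N%:R - l%:R).
      by rewrite ler_pdivlMr; lra.
    apply: le_trans T1le _; rewrite ler_pdivrMr; last lra.
    have -> : (T2 + T2 * 2 / N%:R * l%:R) * (N%:R - l%:R) =
      T2 * N%:R + T2 * (l%:R / N%:R) * (2 * (N%:R - l%:R) - N%:R) by field; rewrite gt_eqF.
    by rewrite lerDl mulr_ge0 ?subr_ge0// mulr_ge0 ?(ltW T20)// divr_ge0// ltW.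
  rewrite big_split/= sumr_const_nat subn0 -mulr_sumr -mulr_sumr lerD2l -mulrnAr ler_wpM2l//.
  rewrite -mulr_natr mulrAC ler_pdivrMr// -mulrA mulrA.
  have -> : 4 * e * N%:R = 2 * e * (2 * N%:R) by ring.
  rewrite ler_wpM2l ?mulr_ge0// -natrM ler_nat.
  by move: MN; rewrite /t; clear; lia.
have B2 : \sum_(t.+1 <= l < N.+1) (N - l).+1%:R * p_tail r (N - l).+1 * h l <=
    alpha * tail N * (4 * e / (1 - alpha)).
  apply: (@le_trans _ _ (\sum_(t.+1 <= l < N.+1) alpha * tail (N - l) * (2 * e / N%:R))).
    rewrite ler_sum_nat// => l /andP[tl lN].
    apply: le_trans (ler_wpM2r (h0 l) (size_biased_p_tail_le _ _)) _.
    rewrite ler_wpM2l ?mulr_ge0 ?(ltW alpha_gt0) ?(ltW (tail_gt0 _))//.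
    have l0 : (0 : R) < l%:R by rewrite ltr0n; case: l tl {lN}.
    have {}lh : h l <= e / l%:R.
      rewrite ler_pdivlMr// mulrC He//.
      by move: MN tl; rewrite /t; clear; lia.
    apply: le_trans lh _; rewrite ler_pdivrMr// mulrAC ler_pdivlMr//.
    rewrite (mulrC 2 e) -mulrA ler_wpM2l// -natrM ler_nat.
    by move: tl; rewrite /t; clear; lia.
  (* The sum is extended to all l so that [sum_tail] evaluates it. *)
  apply: (@le_trans _ _ (\sum_(0 <= l < N.+1) alpha * tail (N - l) * (2 * e / N%:R))).
    rewrite [leRHS](@big_cat_nat _ _ _ t.+1 0 N.+1)//= lerDr sumr_ge0// => l _.
    by rewrite !mulr_ge0 ?(ltW alpha_gt0) ?(ltW (tail_gt0 _)) ?invr_ge0// ltW.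
  rewrite -mulr_suml -mulr_sumr big_mkord.
  rewrite (reindex_inj rev_ord_inj)/=.
  under eq_bigr do rewrite subSS subKn ?leq_ord//.
  rewrite sum_tail -!mulrA ler_wpM2l ?(ltW alpha_gt0)// ler_wpM2l ?(ltW (tail_gt0 _))//.
  have -> : (N.+1%:R - alpha) * ((1 - alpha)^-1 * (2 * (e / N%:R))) =
    2 * e / (1 - alpha) * ((N.+1%:R - alpha) / N%:R).
    by field; rewrite !gt_eqF.
  have -> : 4 * (e / (1 - alpha)) = 2 * e / (1 - alpha) * 2.
    by field; rewrite !gt_eqF.
  rewrite ler_wpM2l ?divr_ge0 ?mulr_ge0 ?(ltW onem_gt0)// ler_pdivrMr//.
  by rewrite -nat1r mulr_natl mulr2n lerBlDr addrC -addrA lerD2l (le_trans N1)// lerDl ltW.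
have Ss : (\sum_(0 <= l < t.+1) h l) * s <= 1.
  by rewrite big_mkord mulrC; exact: sum_comp_coef_tail_le.
apply: (@le_trans _ _ (alpha * tail N * ((1 + 2 * M0%:R / N%:R) + 4 * e) +
    alpha * tail N * (4 * e / (1 - alpha)))); last by rewrite -mulrDr.
apply: lerD; last first.
  apply: le_trans B2; rewrite ler_piMr// sumr_ge0// => l _.
  by rewrite !mulr_ge0 ?p_tail_ge0.
apply: le_trans (ler_wpM2r (ltW s0) B1) _.
rewrite -(mulrA (alpha * _)) ler_wpM2l// mulrDl lerD//; last by rewrite ler_piMr ?mulr_ge0.
by rewrite -(mulrA (1 + _)) ler_piMr// addr_ge0// divr_ge0 ?mulr_ge0// ltW.
Qed.

(** With 2r <= N the range l <= N + 1 - r of the lower bound contains l <= N/2, long enough for the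
    uniform estimate on partial sums. *)
Lemma first_block_sum_cvg g (r : nat -> nat) : 0 < g -> (forall N, (1 < r N)%N) ->
  (\forall N \near \oo, ((r N).*2 <= N)%N) ->
  first_block_sum (r N) g N * (1 - tail (r N).-1) `^ g / (alpha * tail N)
    @[N --> \oo] --> (1 : R).
Proof.
move=> g0 r1 rN; apply/cvgrPdist_le => e e0.
(* Makes 4d and 4d/(1 - alpha) at most e/4 each; the other e/2 absorbs 2 M1/N. *)
pose d := e * (1 - alpha) / 16.
have d0 : 0 < d by rewrite divr_gt0 ?mulr_gt0.
have [M1 HM1] := size_biased_comp_coef_small g0 d0.
have [M2 HM2] := sum_comp_coef_tail_ge g0 e0.
near=> N.
have aN : 0 < alpha * tail N by rewrite mulr_gt0 ?tail_gt0.
have rN2 : ((r N).*2 <= N)%N by near: N.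
have NM2 : (M2.*2 <= N)%N by near: N; exact: nbhs_infty_ge.
have NM1 : (M1.*2 < N)%N by near: N; exact: nbhs_infty_gt.
have N0 : (0 : R) < N%:R by rewrite ltr0n (leq_ltn_trans _ NM1).
have Ne : 4 * M1%:R / e <= N%:R by near: N; exact: nbhs_infty_ger.
rewrite ler_distlC; apply/andP; split.
  rewrite ler_pdivlMr// mulrC.
  have rN1 : (r N <= N.+1)%N by move: rN2; clear; lia.
  have h1 := first_block_sum_ge g0 (ltnW (r1 N)) rN1.
  apply: le_trans (ler_wpM2r (powR_ge0 _ _) h1).
  rewrite -(mulrA (alpha * _)) ler_wpM2l ?(ltW aN)// mulrC HM2//.
  by move: rN2 NM2; clear; lia.
rewrite ler_pdivrMr// [leRHS]mulrC.
have He m : (M1 <= m)%N -> m%:R * comp_coef (p_tail (r N)) g m <= d by move=> /HM1; exact.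
apply: le_trans (first_block_sum_le g0 (r1 N) (ltW d0) He NM1) _.
rewrite ler_wpM2l ?(ltW aN)// -!addrA lerD2l.
have h2 : 2 * M1%:R / N%:R <= e / 2.
  by rewrite ler_pdivrMr//; move: Ne; rewrite ler_pdivrMr//; lra.
have h3 : 4 * d / (1 - alpha) = e / 4 by rewrite /d; field; rewrite gt_eqF.
have h4 : 4 * d <= e / 4.
  rewrite -h3 ler_pdivlMr//; apply: ler_piMr; first by rewrite mulr_ge0 ?ltW.
  by rewrite gerBl ltW.
lra.
Unshelve. all: by end_near. Qed.

End UniformEstimates.


(** * The Ewens-Pitman law *)

Section EwensPitmanSums.
Context {R : realType} (alpha : R).
Hypotheses (alpha_gt0 : 0 < alpha) (alpha_lt1 : alpha < 1).
Variable (r : nat).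
Hypothesis r_gt0 : (0 < r)%N.

(** The value 0 below r removes every partition with a block that is too small. *)
Definition block_weight (b : nat) : R :=
  if (r <= b)%N then rising (1 - alpha) b.-1 1 else 0.

Lemma block_weight_p_tail i :
  alpha * block_weight i.+1 = i`!%:R * (i.+1%:R * p_tail alpha r i.+1).
Proof.
rewrite /block_weight /p_tail; case: ifP => _; last by rewrite !mulr0n !mulr0.
by rewrite mulr1n p_alpha_tail// tailE mulrCA (mulrC i`!%:R) divfK// pnatr_eq0 -lt0n fact_gt0.
Qed.

Lemma partition_sum_scale (w v : nat -> R) (c : R) (T : finType) (D : {set T}) :
  partition_sum w (fun k => c * v k) D = c * partition_sum w v D.
Proof. by rewrite /partition_sum mulr_sumr; apply: eq_bigr => A _; rewrite mulrA. Qed.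

(** The identity C(N,i) i! (N - i)! = N! turns block removal into a convolution. The formula for the
    remaining set is a hypothesis, so that this serves both within the induction and after it. *)
Lemma sum_pblock_comp_coef g N (T : finType) (D : {set T}) x : x \in D -> #|D| = N.+1 ->
  (forall S : {set T}, (S \subset D) && (x \in S) ->
     partition_sum block_weight (fun k => rising (alpha * g) k alpha) (D :\: S)%SET =
     (#|(D :\: S)%SET|)`!%:R * comp_coef (p_tail alpha r) g #|(D :\: S)%SET|) ->
  \sum_(S : {set T} | (S \subset D) && (x \in S)) alpha * block_weight #|S| *
    partition_sum block_weight (fun k => rising (alpha * g) k alpha) (D :\: S)%SET =
  N`!%:R * first_block_sum alpha r g N.
Proof.
move=> xD DN H.
rewrite (eq_bigr (fun S : {set T} => alpha * block_weight #|S| *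
  ((#|(D :\: S)%SET|)`!%:R * comp_coef (p_tail alpha r) g #|(D :\: S)%SET|))); last first.
  by move=> S SD; rewrite H.
rewrite (@sum_subsets_with _ _ D x
  (fun a b => alpha * block_weight a * (b`!%:R * comp_coef (p_tail alpha r) g b)))//.
rewrite DN /= /first_block_sum mulr_sumr; apply: eq_bigr => i _.
have iN : (i <= N)%N by rewrite -ltnS.
by rewrite block_weight_p_tail -(bin_fact iN) -mulr_natl !natrM; ring.
Qed.

(** Exponential formula, by induction on the size of D with g free: removing a block splits off
    alpha g and shifts g to g + 1, exactly as in [comp_coefS]. *)
Lemma partition_sum_rising g (T : finType) (D : {set T}) :
  partition_sum block_weight (fun k => rising (alpha * g) k alpha) D =
  (#|D|)`!%:R * comp_coef (p_tail alpha r) g #|D|.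
Proof.
have [k] := ubnP #|D|; elim: k g D => // k IH g D Dk.
have [->|/finset.set0Pn[x xD]] := eqVneq D finset.set0.
  by rewrite partition_sum0 rising0 finset.cards0 comp_coef0 ?p_tail0// mulr1.
case DN : #|D| => [|N]; first by move: xD; rewrite (finset.cards0_eq DN) finset.inE.
rewrite (partition_sum_pblock _ _ xD).
have -> : (fun k => rising (alpha * g) k.+1 alpha) =
    (fun k => alpha * g * rising (alpha * (g + 1)) k alpha).
  by apply/funext => j; rewrite risingSl mulrDr mulr1.
rewrite (eq_bigr (fun S : {set T} => g * (alpha * block_weight #|S| * partition_sum block_weight
    (fun k => rising (alpha * (g + 1)) k alpha) (D :\: S)%SET))); last first.
  by move=> S _; rewrite partition_sum_scale; ring.
rewrite -mulr_sumr (sum_pblock_comp_coef xD DN) => [|S /andP[SD xS]].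
  rewrite factS natrM (mulrC N.+1%:R) -mulrA comp_coefS ?p_tail0//.
  by rewrite mulrCA.
apply: IH; rewrite -ltnS (leq_trans _ Dk)// ltnS proper_card// properE finset.subsetDl.
by apply/negP => /fintype.subsetP/(_ x xD); rewrite finset.in_setD xS.
Qed.

End EwensPitmanSums.

(** * The exact probability that all blocks have size at least r *)

Lemma sum_EP_prob (R : realType) (alpha theta : R) (r N : nat) :
  0 < alpha -> alpha < 1 -> - alpha < theta -> (0 < r)%N ->
  \sum_(A : {set {set 'I_N.+1}} | finset.partition A [set: 'I_N.+1]%SET &&
      [forall B in A, (r <= #|B|)%N]) EP_prob alpha theta A =
  N`!%:R / rising (theta + 1) N 1 * first_block_sum alpha r (1 + theta / alpha) N / alpha.
Proof.
move=> a0 a1 ta r0.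
have t10 : 0 < theta + 1 by rewrite -ltrBlDr sub0r (lt_trans _ ta)// ltrN2.
set g := 1 + theta / alpha.
have ag : alpha * g = theta + alpha by rewrite /g; field; rewrite gt_eqF.
(* With at least one block, theta cancels, so theta = 0 and theta != 0 share one formula with
   positive parameter alpha g = theta + alpha. *)
have EPr k : EP_ratio alpha theta N.+1 k.+1 =
    (rising (theta + 1) N 1)^-1 * rising (alpha * g) k alpha.
  rewrite /EP_ratio ag [RHS]mulrC; case: eqVneq => //= t0.
  by rewrite !risingSl invfM mulrACA divff// mul1r.
have -> : \sum_(A : {set {set 'I_N.+1}} | finset.partition A [set: 'I_N.+1]%SET &&
      [forall B in A, (r <= #|B|)%N]) EP_prob alpha theta A =
    partition_sum (block_weight alpha r) (EP_ratio alpha theta N.+1) [set: 'I_N.+1]%SET.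
  rewrite big_mkcondr; apply: eq_bigr => A _; rewrite /EP_prob.
  case: ifPn => [/forall_inP Ar|].
    by congr (_ * _); apply: eq_bigr => B BA; rewrite /block_weight Ar.
  rewrite negb_forall_in => /exists_inP[B BA]; rewrite -ltnNge => Br.
  by rewrite (bigD1 B)//= /block_weight leqNgt Br mul0r mulr0.
rewrite (partition_sum_pblock _ _ (finset.in_setT ord0)).
have -> : (fun k => EP_ratio alpha theta N.+1 k.+1) =
    (fun k => (rising (theta + 1) N 1)^-1 * rising (alpha * g) k alpha).
  by apply/funext => k; exact: EPr.
rewrite (eq_bigr (fun S : {set 'I_N.+1} => (rising (theta + 1) N 1)^-1 / alpha *
    (alpha * block_weight alpha r #|S| * partition_sum (block_weight alpha r)
      (fun k => rising (alpha * g) k alpha) ([set: 'I_N.+1] :\: S)%SET))); last first.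
  by move=> S _; rewrite partition_sum_scale; field; rewrite !gt_eqF// rising_gt0.
rewrite -mulr_sumr (sum_pblock_comp_coef (N := N) (finset.in_setT ord0)); first by ring.
- by rewrite finset.cardsT card_ord.
- by move=> S _; rewrite partition_sum_rising.
Qed.

Lemma leq_last_sorted_geq (r : nat) (s : seq nat) : (0 < r)%N -> s != [::] ->
  sorted geq s -> (r <= last 0%N s)%N = all (leq r) s.
Proof.
move=> r0; case: s => // x s _ /=; elim: s x => [|y s IH] x /=; first by rewrite andbT.
move=> /andP[yx ys]; rewrite IH//= andbA; congr (_ && _).
by apply/idP/andP => [ry|[]//]; split => //; exact: leq_trans ry yx.
Qed.

(** The ground set is nonempty, so A has a block and the default 0 of [last] is never returned. *)
Lemma leq_smallest_block_size (r N : nat) (A : {set {set 'I_N.+1}}) : (0 < r)%N ->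
  finset.partition A [set: 'I_N.+1]%SET ->
  (r <= smallest_block_size A)%N = [forall B in A, (r <= #|B|)%N].
Proof.
move=> r0 pA; rewrite /smallest_block_size /block_sizes.
have [B0 B0A] : exists B, B \in A.
  exists (finset.pblock A ord0); apply: finset.pblock_mem.
  by rewrite (finset.cover_partition pA) finset.in_setT.
rewrite leq_last_sorted_geq//.
- rewrite all_sort all_map; apply/allP/forall_inP => H B.
    by move=> BA; apply: H; rewrite mem_enum.
  by rewrite mem_enum; exact: H.
- rewrite -size_eq0 size_sort size_image -lt0n; apply/card_gt0P; by exists B0.
- by apply: sort_sorted => m n; exact: leq_total.
Qed.

(** The event is a finite disjoint union of fibres of [Pi]. *)
Lemma EwensPitman_smallest_block (R : realType) (alpha theta : R) (r N : nat)
    (d : measure_display) (T : measurableType d) (P : probability T R)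
    (Pi : T -> {set {set 'I_N.+1}}) :
  0 < alpha -> alpha < 1 -> - alpha < theta -> (0 < r)%N ->
  EwensPitman alpha theta P Pi ->
  fine (P [set w | (r <= smallest_block_size (Pi w))%N]) =
  N`!%:R / rising (theta + 1) N 1 * first_block_sum alpha r (1 + theta / alpha) N / alpha.
Proof.
move=> a0 a1 ta r0 EP; rewrite -sum_EP_prob//.
pose s := enum [pred A : {set {set 'I_N.+1}} | finset.partition A [set: 'I_N.+1]%SET &&
      [forall B in A, (r <= #|B|)%N]].
have sP A : A \in s = finset.partition A [set: 'I_N.+1]%SET && [forall B in A, (r <= #|B|)%N].
  by rewrite mem_enum inE.
have -> : [set w | (r <= smallest_block_size (Pi w))%N] =
    \bigcup_(A in [set` s]) Pi @^-1` [set A].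
  apply/seteqP; split => [w /= rw|w [A /= As wA]].
    exists (Pi w) => //=; rewrite sP (EP_partition EP)/=.
    by rewrite -leq_smallest_block_size// (EP_partition EP).
  by move: As; rewrite wA sP => /andP[pA]; rewrite leq_smallest_block_size.
rewrite measure_fin_bigcup//; last 2 first.
- by move=> A B _ _ [w [/= <- <-]].
- by move=> A _; exact: (EP_measurable EP).
rewrite -fsbig_seq ?enum_uniq//.
rewrite (eq_big_seq (fun A => (EP_prob alpha theta A)%:E)); last first.
  by move=> A; rewrite sP => /andP[pA _]; exact: (EP_law EP).
by rewrite sumEFin /= /s big_enum.
Qed.


(** * Asymptotics of the smallest block size *)

Theorem theorem4p3 (R : realType) (alpha theta : R)
    (alpha_gt0 : 0 < alpha) (alpha_lt1 : alpha < 1) (theta_gt : - alpha < theta)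
    (d : nat -> measure_display) (T : forall n, measurableType (d n))
    (P : forall n, probability (T n) R)
    (Pi : forall n, T n -> {set {set 'I_n}})
    (EP : forall n, (0 < n)%N -> EwensPitman alpha theta (P n) (Pi n))
    (r : nat -> nat) (r_ge2 : forall n, (2 <= r n)%N)
    (r_o : (fun n => (r n)%:R : R) =o_\oo (fun n => n%:R : R)) :
  asymp_equiv
    (fun n => fine (P n [set w | (r n <= smallest_block_size (Pi n w))%N]))
    (fun n => Gamma (1 + theta) / Gamma (1 - alpha) *
              (\sum_(1 <= j < r n) p_alpha alpha j) `^ (-1 - theta / alpha) *
              n%:R `^ (- theta - alpha))
  /\ (r n @[n --> \oo] --> \oo ->
      asymp_equiv
        (fun n => fine (P n [set w | (r n <= smallest_block_size (Pi n w))%N]))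
        (fun n => Gamma (1 + theta) / Gamma (1 - alpha) *
                  n%:R `^ (- theta - alpha))).
Proof.
have t10 : 0 < 1 + theta by rewrite addrC -ltrBlDr sub0r (lt_trans _ theta_gt)// ltrN2.
have a10 : 0 < 1 - alpha by rewrite subr_gt0.
have a_neq0 : alpha != 0 by rewrite gt_eqF.
pose g := 1 + theta / alpha.
have g0 : 0 < g by rewrite /g -(divff a_neq0) -mulrDl divr_gt0// -ltrBlDl sub0r.
have G1 := Gamma_gt0 t10; have G2 := Gamma_gt0 a10.
(* The constant 1/4 leaves room for n = N + 1: from 4r <= N + 1 follows 2r <= N once N >= 1. *)
have r_half : \forall N \near \oo, ((r N.+1).*2 <= N)%N.
  have quarter : (0 : R) < 4^-1 by rewrite invr_gt0.
  have [n0 _ Hn0] := (eqoP _ _ _).1 r_o _ quarter.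
  exists n0.+1 => //= N nN.
  have := Hn0 N.+1 (leqW (ltnW nN)); rewrite /= !normr_nat mulrC ler_pdivlMr// -natrM ler_nat.
  by move: nN; clear; lia.
pose s n := 1 - tail alpha (r n).-1.
have sE n : \sum_(1 <= j < r n) p_alpha alpha j = s n.
  by rewrite /s -sum_p_alpha// prednK// (leq_trans _ (r_ge2 n)).
have s_gt0 n : 0 < s n.
  have /andP[_ h] := tail_bounds alpha_gt0 alpha_lt1 (r_ge2 n).
  by rewrite /s subr_gt0 (le_lt_trans h)// gtrBl.
have main : asymp_equiv
    (fun n => fine (P n [set w | (r n <= smallest_block_size (Pi n w))%N]))
    (fun n => Gamma (1 + theta) / Gamma (1 - alpha) * s n `^ (- g) * n%:R `^ (- theta - alpha)).
  rewrite /asymp_equiv -cvg_shiftS.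
  have lim1 : N`!%:R * N.+1%:R `^ (1 + theta - 1) / rising (1 + theta) N 1 @[N --> \oo]
      --> Gamma (1 + theta) by exact: Gamma_limit.
  have lim2 : (N`!%:R * N.+1%:R `^ (1 - alpha - 1) / rising (1 - alpha) N 1)^-1 @[N --> \oo]
      --> (Gamma (1 - alpha))^-1.
    by apply: cvgV; [rewrite gt_eqF|exact: Gamma_limit].
  have lim3 := first_block_sum_cvg alpha_gt0 alpha_lt1 g0 (fun N => r_ge2 N.+1) r_half.
  move: (Gamma (1 + theta)) (Gamma (1 - alpha)) G1 G2 lim1 lim2 => c1 c2 c1_gt0 c2_gt0 lim1 lim2.
  (* The quotient factors into Euler's quotient at 1 + theta, the inverse one at 1 - alpha (that is,
     (N + 1)^alpha [tail N]), the normalised block sum and a constant. *)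
  have lim : N`!%:R * N.+1%:R `^ (1 + theta - 1) / rising (1 + theta) N 1 *
      (N`!%:R * N.+1%:R `^ (1 - alpha - 1) / rising (1 - alpha) N 1)^-1 *
      (first_block_sum alpha (r N.+1) g N * s N.+1 `^ g / (alpha * tail alpha N)) *
      (c1 / c2)^-1 @[N --> \oo] --> (1 : R).
    have c1V : c1 / c2 * 1 * (c1 / c2)^-1 = 1.
      by rewrite mulr1 divff// mulf_neq0 ?invr_neq0 ?gt_eqF.
    rewrite -[X in _ --> X]c1V; apply: cvgM; last exact: cvg_cst.
    by apply: cvgM lim3; exact: cvgM.
  apply: cvg_trans lim; apply: near_eq_cvg; apply: nearW => N /=.
  have N1 : (0 : R) < N.+1%:R by rewrite ltr0n.
  have fN : (0 : R) < N`!%:R by rewrite ltr0n fact_gt0.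
  rewrite (EwensPitman_smallest_block _ _ theta_gt _ (EP N.+1 isT)) ?(ltnW (r_ge2 _))//.
  rewrite tailE (addrC 1 theta) addrK (addrAC 1) subrr add0r -/g.
  rewrite (@powRD _ N.+1%:R); last by rewrite (gt_eqF N1) implybT.
  rewrite !powRN.
  rewrite (addrC theta 1).
  have := powR_gt0 theta N1; have := powR_gt0 alpha N1; have := powR_gt0 g (s_gt0 N.+1).
  have := rising_gt0 N t10 ler01; have := rising_gt0 N a10 ler01.
  move: (first_block_sum _ _ _ _) (rising _ _ _) (rising _ _ _) (_ `^ _) (_ `^ _) (_ `^ _).
  move=> F r1 r2 p1 p2 p3 r1_gt0 r2_gt0 p1_gt0 p2_gt0 p3_gt0.
  by field; rewrite !gt_eqF.
split.
  rewrite (_ : -1 - theta / alpha = - g); last by rewrite /g opprD.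
  by under [X in asymp_equiv _ X]funext do rewrite sE.
move=> r_oo.
have lim_s : s n `^ (- g) @[n --> \oo] --> (1 : R).
  rewrite -[X in _ --> X](_ : (1 - 0) `^ (- g) = 1); last by rewrite subr0 powR1.
  apply: (@cvg_powR R nat \oo _ s); first by rewrite subr0.
  apply: cvgB; first exact: cvg_cst.
  apply: (@cvg_comp _ _ _ r (fun m => tail alpha m.-1) _ _ _ r_oo).
  by rewrite -cvg_shiftS; exact: cvg_tail.
have lim := cvgM main lim_s; rewrite mulr1 in lim.
rewrite /asymp_equiv; apply: cvg_trans (lim _); apply: near_eq_cvg; apply: nearW => n /=.
have sg0 : s n `^ (- g) != 0 by rewrite gt_eqF// powR_gt0.
move: (fine _) (Gamma _ / _) => p c.
by rewrite (mulrAC c) invfM mulrA divfK.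
Qed.
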